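(* Let $n\ge1$, let $\eta_1,\dots,\eta_n\in\mathbb T$ be distinct points, let $q_1,\dots,q_n\in\mathbb R$, let $p\ge0$, let $D>0$, and let $|R(z)|=\prod_{j=1}^n|z-\eta_j|^{q_j}$. Suppose $f$ is holomorphic in $\mathbb D$, $|f(0)|=1$, and $$|f(z)|\le\exp\frac{D}{(1-|z|^2)^p\,|R(z)|}\qquad\text{for all }z\in\mathbb D.$$ (i) If $p=0$, then for every $\epsilon>0$, with $|R_\epsilon(z)|:=\prod_{j=1}^n|z-\eta_j|^{(q_j-1+\epsilon)_+}$, $$\sum_{a\in Z(f)}(1-|a|)\,|R_\epsilon(a)|\le D\,c,$$ where $c$ depends only on $\epsilon$ and $R$. (ii) If $p>0$, define $\tilde q_j:=q_j$ when $q_j-1>-p/2$, and otherwise let $\tilde q_j$ be any chosen real number with $\tilde q_j>1-p/2$; put $|\tilde R_0(z)|:=\prod_{j=1}^n|z-\eta_j|^{\tilde q_j-1}$. Then for every $\epsilon>0$, $$\sum_{a\in Z(f)}(1-|a|)^{1+p+\epsilon}\,|\tilde R_0(a)|\le D\,c,$$ where $c$ depends only on $\epsilon$, $p$, $R$ and the numbers $\tilde q_j$.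
   Context: $\mathbb D$ is the open unit disc of $\mathbb C$, $\mathbb T=\partial\mathbb D$. $Z(f)$ is the set of zeros of $f$ in $\mathbb D$, counted with multiplicity. $x_+=\max(x,0)$. *)

(* Defs.v *)
From HB Require Import structures.
From mathcomp Require Import all_boot all_order all_algebra.
From mathcomp Require Import complex.
From mathcomp Require Import all_classical all_reals all_analysis.

Set Implicit Arguments.
Unset Strict Implicit.
Unset Printing Implicit Defensive.

Import Order.TTheory GRing.Theory Num.Theory.
Import numFieldNormedType.Exports.

Local Open Scope classical_set_scope.
Local Open Scope ring_scope.
Local Open Scope complex_scope.

(* The R-valued modulus: `|z| on R[i] takes its values in R[i]. *)
Definition cmod (R : realType) (z : R[i]) : R := Normc.normc z.

Definition unit_disc (R : realType) : set R[i] := [set z | cmod z < 1].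

Definition unit_circle (R : realType) : set R[i] := [set z | cmod z = 1].

(* R[i]^o carries the normed R[i]-module structure, so this is complex
   differentiability. The values of f outside the disc are irrelevant. *)
Definition holomorphic_disc (R : realType) (f : R[i] -> R[i]) : Prop :=
  forall z, unit_disc z -> derivable (f : R[i]^o -> R[i]^o) z 1.

Definition zeros (R : realType) (f : R[i] -> R[i]) : set R[i] :=
  [set a | unit_disc a /\ f a = 0].

Definition vanishes_to_order (R : realType) (f : R[i] -> R[i]) (a : R[i])
    (m : nat) : Prop :=
  exists g : R[i] -> R[i],
    [/\ holomorphic_disc g, g a != 0 &
        forall z, unit_disc z -> f z = (z - a) ^+ m * g z].

(* For f holomorphic and not identically zero on the disc, such an m exists and
   is unique; the default value 0 is then never used. *)
Definition multiplicity (R : realType) (f : R[i] -> R[i]) (a : R[i]) : nat :=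
  xget 0%N [set m | vanishes_to_order f a m].

(* Sum over the zeros of f repeated according to multiplicity; w is meant to be
   nonnegative on the disc, and the sum may be +oo. *)
Definition sum_zeros (R : realType) (f : R[i] -> R[i]) (w : R[i] -> R) : \bar R :=
  \esum_(a in zeros f) ((multiplicity f a)%:R * w a)%:E.

Definition prod_dist (R : realType) (n : nat) (eta : 'I_n -> R[i])
    (e : 'I_n -> R) (z : R[i]) : R :=
  \prod_(j < n) (cmod (z - eta j) `^ e j).

Definition pos_part (R : realType) (x : R) : R := Num.max x 0.

Definition growth_bound (R : realType) (n : nat) (eta : 'I_n -> R[i])
    (q : 'I_n -> R) (p D : R) (f : R[i] -> R[i]) : Prop :=
  forall z, unit_disc z ->
    cmod (f z) <=
      expR (D / ((1 - cmod z ^+ 2) `^ p * prod_dist eta q z)).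

(* Main.v *)
Require Import Defs.
From HB Require Import structures.
From mathcomp Require Import all_boot all_order all_algebra.
From mathcomp Require Import complex.
From mathcomp Require Import all_classical all_reals all_analysis.
From mathcomp Require Import ring lra.

Import Order.TTheory GRing.Theory Num.Theory.
Import numFieldNormedType.Exports.

Local Open Scope classical_set_scope.
Local Open Scope ring_scope.
Local Open Scope complex_scope.

Local Notation Re := complex.Re.
Local Notation Im := complex.Im.

(** Write t_j(z) = |z - eta_j| and X(z) = 1 - |z|^2 (called [gap]), and let
    V = X^p * prod_j t_j^beta_j with beta_j >= q_j - 1 + delta for a small
    delta > 0. The heart of the proof is that, for every level y > 0,

      the sum of X(a) over the zeros a with X(a)^(p delta) V(a) >= K y,
      counted with multiplicity, is at most c D / y            ([sum_gap_le]).

    Where V >= y, the growth bound says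
    log |f| <= D / (X^p prod_j t_j^q_j) <= (c D / y) sum_j t_j^-(1 - delta),
    since 1/V <= 1/y and what remains of the exponents is at least -(1 - delta).
    An exponent above -1 is what a positive harmonic function can afford: a
    finite positive combination of Herglotz kernels, whose value at 0 is bounded,
    dominates t_j^-(1 - delta) ([dkern_ge], [dkern0_le], [inv_growth_le]).
    So log |f| has, on the region {V >= y}, a harmonic majorant whose value at 0
    is of order D / y.

    Zeros are then counted by the maximum principle instead of an integral
    formula. Let b_a(z) = (z - a) / (1 - conj(a) z). If h_a is holomorphic with
    |b_a| exp (X(a) Re h_a) >= 1 on the boundary of {|z| <= r, V >= y}, then f
    divided by all the factors b_a exp (X(a) h_a) and by exp E, with Re E the
    harmonic majorant, has modulus at most 1 on that boundary, hence at 0. If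
    moreover Re h_a(0) <= 1/4, taking logarithms at 0 gives the sum of X(a)
    ([sum_multiplicity_le]). By the identity
    1 - |b_a(z)|^2 = X(a) X(z) / |1 - conj(a) z|^2 it suffices that Re h_a
    dominates X(z) / |1 - conj(a) z|^2. At a boundary point z either |z| = r is
    close to 1 or V(z) = y, and V(a) is much larger than V(z); so one of the
    factors of V is much larger at a than at z ([weight_trichotomy]):
    - X(a) is much larger than X(z), and the Herglotz kernel of a dominates;
    - t_j(a) is much larger than t_j(z), so that |1 - conj(a) z| is at least
      t_j(a) / 2, and a small multiple of the Herglotz kernel of eta_j dominates;
    - beta_j < 0 and t_j(z) is much larger than t_j(a). Then V(z) = y forces
      X(z) <= M t_j(z)^(1 + delta) with M small ([far_case]); as
      |1 - conj(a) z| >= t_j(z) / 2, the quotient is at most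
      4 M t_j(z)^-(1 - delta), which again has a harmonic majorant. This is where
      beta_j >= -p and the additional factor X(a)^(p delta) are used.

    Adding up dyadic levels y turns the estimate into a bound for the sum of
    X(a) (X(a)^(p delta) V(a))^(1 + delta) ([sum_gap_weight_le]); with delta small
    this controls the weights of the theorem. For (i), p = 0 and
    beta_j = (q_j - 1 + delta)_+; for (ii), beta_j = qt_j - 1 + delta, and the
    lost powers of t_j are paid for by X^eps, as X <= 2 t_j.

    The maximum principle is proved here for functions that are merely complex
    differentiable at each point: Goursat's theorem on the rectangles
    [a, b] x [0, 2 pi], applied to w |-> F(z0 + exp w), shows that the means of F
    over small circles around z0 do not depend on the radius. *)

(** * Quadrisection of rectangles *)

Section Bisection.
Variable R : realType.
Implicit Types (a b c d x y e r : R) (n : nat).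

Lemma exists_small_halves (s r : R) : 0 < r -> exists n, s / 2 ^+ n < r.
Proof.
move=> r0.
exists (Num.bound (`|s| / r)).
set k := Num.bound _.
have k1 : `|s| / r < k%:R by rewrite archi_boundP// divr_ge0 // ltW.
have k2 : (k%:R : R) <= 2 ^+ k by rewrite -natrX ler_nat ltnW // ltn_expl.
rewrite ltr_pdivrMr ?exprn_gt0 //.
apply: le_lt_trans (ler_norm s) _.
by rewrite -ltr_pdivrMl // mulrC; apply: lt_le_trans k1 k2.
Qed.

(** Goursat's bisection in abstract form: an additive function of rectangles that
    does not vanish keeps at least a quarter of its size on one of the four
    quarters, so its size divided by the squared perimeter does not tend to 0 along
    some nested sequence, which contradicts the local estimate at the limit point. *)
Lemma quadrisection_eq0 (J : R -> R -> R -> R -> R) a b c d :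
  a <= b -> c <= d ->
  (forall a' m b' c' d', a <= a' -> a' <= m -> m <= b' -> b' <= b ->
     c <= c' -> c' <= d' -> d' <= d -> J a' b' c' d' = J a' m c' d' + J m b' c' d') ->
  (forall a' b' c' m d', a <= a' -> a' <= b' -> b' <= b ->
     c <= c' -> c' <= m -> m <= d' -> d' <= d -> J a' b' c' d' = J a' b' c' m + J a' b' m d') ->
  (forall x y e, a <= x <= b -> c <= y <= d -> 0 < e ->
     exists2 r, 0 < r & forall a' b' c' d',
       a <= a' -> a' <= x <= b' -> b' <= b -> c <= c' -> c' <= y <= d' -> d' <= d ->
       b' - a' < r -> d' - c' < r ->
       `|J a' b' c' d'| <= e * ((b' - a') + (d' - c')) ^+ 2) ->
  J a b c d = 0.
Proof.
move=> ab cd addx addy loc.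
apply/eqP; apply/negPn/negP => J0.
set j := `|J a b c d|; have j0 : 0 < j by rewrite normr_gt0.
(* side lengths of the rectangles of generation n; z n is a lower left corner *)
pose s n := (b - a) / 2 ^+ n; pose t n := (d - c) / 2 ^+ n.
have sS n : s n = s n.+1 + s n.+1.
  by rewrite /s exprS; field; rewrite expf_neq0.
have tS n : t n = t n.+1 + t n.+1.
  by rewrite /t exprS; field; rewrite expf_neq0.
have s0 n : 0 <= s n by rewrite divr_ge0 ?subr_ge0 // exprn_ge0.
have t0 n : 0 <= t n by rewrite divr_ge0 ?subr_ge0 // exprn_ge0.
pose P n (p : R * R) := [/\ a <= p.1, p.1 + s n <= b, c <= p.2, p.2 + t n <= d &
   j <= 4 ^+ n * `|J p.1 (p.1 + s n) p.2 (p.2 + t n)|].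
pose N n (p p' : R * R) := [/\ p.1 <= p'.1, p'.1 + s n.+1 <= p.1 + s n,
   p.2 <= p'.2 & p'.2 + t n.+1 <= p.2 + t n].
have step n p : P n p -> exists p', P n.+1 p' /\ N n p p'.
  case: p => x y [/= ax xb cy yd jJ].
  move: xb yd jJ (s0 n.+1) (t0 n.+1); rewrite /N /P /= (sS n) (tS n).
  move: (s n.+1) (t n.+1) => s2 t2 xb yd jJ s20 t20.
  rewrite ![_ + (_ + _)]addrA in xb yd jJ *.
  have xs u : u <= u + s2 by rewrite lerDl.
  have ys u : u <= u + t2 by rewrite lerDl.
  have xss := le_trans (xs x) (xs _); have yss := le_trans (ys y) (ys _).
  have ax2 := le_trans ax (xs x); have cy2 := le_trans cy (ys y).
  have xb2 := le_trans (xs _) xb; have yd2 := le_trans (ys _) yd.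
  have E : J x (x + s2 + s2) y (y + t2 + t2) =
      J x (x + s2) y (y + t2) + J (x + s2) (x + s2 + s2) y (y + t2) +
      (J x (x + s2) (y + t2) (y + t2 + t2) + J (x + s2) (x + s2 + s2) (y + t2) (y + t2 + t2)).
    by rewrite (addy _ _ _ (y + t2)) //; congr (_ + _); apply: addx.
  have D : exists x' y', [/\ x' = x \/ x' = x + s2, y' = y \/ y' = y + t2 &
      j <= 4 ^+ n.+1 * `|J x' (x' + s2) y' (y' + t2)|].
    apply: contrapT => /forallNP H.
    have K x' y' : x' = x \/ x' = x + s2 -> y' = y \/ y' = y + t2 ->
        4 ^+ n * `|J x' (x' + s2) y' (y' + t2)| < j / 4.
      move=> hx hy; rewrite ltr_pdivlMr // mulrC mulrA -exprS ltNge; apply/negP => L.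
      by apply: (H x'); exists y'.
    have := K x y (or_introl erefl) (or_introl erefl).
    have := K (x + s2) y (or_intror erefl) (or_introl erefl).
    have := K x (y + t2) (or_introl erefl) (or_intror erefl).
    have := K (x + s2) (y + t2) (or_intror erefl) (or_intror erefl).
    move: jJ; rewrite E.
    set A := J _ _ _ _; set B := J _ _ _ _; set C := J _ _ _ _; set D := J _ _ _ _.
    move=> jJ h1 h2 h3 h4.
    have T : `|A + B + (C + D)| <= `|A| + `|B| + (`|C| + `|D|).
      by rewrite (le_trans (ler_normD _ _)) // lerD // ler_normD.
    have p4 : 0 < 4 ^+ n :> R by rewrite exprn_gt0.
    have := ler_wpM2l (ltW p4) T; rewrite !mulrDr => T'.
    by lra.
  have [x' [y' [hx hy L]]] := D.
  by exists (x', y'); split; split => //=; case: hx => ?; case: hy => ?; subst.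
pose f n p := xget p [set p' | P n.+1 p' /\ N n p p'].
pose z := fix z n := if n is m.+1 then f m (z m) else (a, c).
have Pz n : P n (z n) /\ N n (z n) (z n.+1).
  have key m : P m (z m) -> P m.+1 (z m.+1) /\ N m (z m) (z m.+1).
    move=> /step Pm; rewrite /z -/z /= /f; case: xgetP => [p _ [] //|h].
    by case: Pm => p /h.
  have : P n (z n).
    elim: n => [|n IH]; last by case: (key n IH).
    by rewrite /P /s /t /= !expr0 !divr1 mul1r; split; rewrite ?subrKC // /j; lra.
  by move=> Pn; split => //; case: (key n Pn).
have mono n k : (n <= k)%N -> [/\ (z n).1 <= (z k).1, (z k).1 + s k <= (z n).1 + s n,
   (z n).2 <= (z k).2 & (z k).2 + t k <= (z n).2 + t n].
  elim: k => [|k IH]; first by rewrite leqn0 => /eqP ->; split.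
  rewrite leq_eqVlt => /predU1P[<-|]; first by split.
  rewrite ltnS => /IH [h1 h2 h3 h4]; have [_ [g1 g2 g3 g4]] := Pz k.
  by split; apply: le_trans; eauto.
have bound n k : (z k).1 <= (z n).1 + s n /\ (z k).2 <= (z n).2 + t n.
  have [/mono [h1 h2 h3 h4]|/ltnW/mono [h1 h2 h3 h4]] := leqP n k.
    by split; [apply: le_trans h2 | apply: le_trans h4]; rewrite lerDl.
  by split; [apply: le_trans h1 _ | apply: le_trans h3 _]; rewrite lerDl.
pose X := sup (range (fun n => (z n).1)); pose Y := sup (range (fun n => (z n).2)).
have hX n : (z n).1 <= X <= (z n).1 + s n.
  apply/andP; split.
    apply: ub_le_sup; last by exists n.
    by exists ((z 0).1 + s 0) => _ [k _ <-]; case: (bound 0 k).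
  by apply: ge_sup; [exists (z 0).1, 0%N | move=> _ [k _ <-]; case: (bound n k)].
have hY n : (z n).2 <= Y <= (z n).2 + t n.
  apply/andP; split.
    apply: ub_le_sup; last by exists n.
    by exists ((z 0).2 + t 0) => _ [k _ <-]; case: (bound 0 k).
  by apply: ge_sup; [exists (z 0).2, 0%N | move=> _ [k _ <-]; case: (bound n k)].
pose L := (b - a) + (d - c).
have L0 : 0 <= L by rewrite /L; lra.
have e0 : 0 < j / (2 * (L ^+ 2 + 1)).
  by rewrite divr_gt0 // mulr_gt0 // ltr_wpDl // sqr_ge0.
have aX : a <= X <= b by have := hX 0%N; rewrite /s /= expr0 divr1 subrKC.
have cY : c <= Y <= d by have := hY 0%N; rewrite /t /= expr0 divr1 subrKC.
have [r r0 hr] := loc X Y _ aX cY e0.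
have [n hn] := exists_small_halves L r r0.
have snr : s n < r.
  apply: le_lt_trans hn; rewrite /s ler_pM2r ?invr_gt0 ?exprn_gt0 // /L; lra.
have tnr : t n < r.
  apply: le_lt_trans hn; rewrite /t ler_pM2r ?invr_gt0 ?exprn_gt0 // /L; lra.
have [[h1 h2 h3 h4 h5] _] := Pz n.
have := hr _ ((z n).1 + s n) _ ((z n).2 + t n) h1 (hX n) h2 h3 (hY n) h4.
rewrite ![_ + _ - _]addrAC !subrr !add0r => /(_ snr tnr).
have -> : s n + t n = L / 2 ^+ n by rewrite /s /t -mulrDl.
rewrite expr_div_n -exprM muln2 -addnn exprD -exprMn_comm; last exact: mulrC.
have -> : (2 * 2 : R) = 4 by rewrite -natrM.
move=> U; have p4 : 0 < 4 ^+ n :> R by rewrite exprn_gt0.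
have := ler_wpM2l (ltW p4) U; rewrite mulrCA [_ * (_ / _)]mulrCA divff ?gt_eqF // mulr1.
move=> /(le_trans h5); rewrite -mulrA => W.
have : j <= j / 2.
  apply: le_trans W _; rewrite invfM; rewrite ler_pM2l // -mulrA.
  rewrite ger_pMr // ler_pdivrMl ?ltr_wpDl ?sqr_ge0 // mulr1; lra.
lra.
Qed.

End Bisection.

(** * Goursat's theorem on rectangles *)

Section Goursat.
Variable R : realType.
Implicit Types (a b c d x y e r : R) (phi psi : R -> R).

Definition itg phi a b := \int[lebesgue_measure]_(x in `[a, b]) phi x.

Definition cont_on phi a b := forall x, a <= x <= b -> {for x, continuous phi}.

Lemma cont_onW phi a b a' b' : a <= a' -> b' <= b -> cont_on phi a b -> cont_on phi a' b'.
Proof.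
move=> aa bb ph x /andP[h1 h2]; apply: ph.
by rewrite (le_trans aa h1) (le_trans h2 bb).
Qed.

Lemma cont_onB phi psi a b : cont_on phi a b -> cont_on psi a b ->
  cont_on (fun x => phi x - psi x) a b.
Proof. by move=> h1 h2 x hx; apply: cvgB; [apply: h1 | apply: h2]. Qed.

Lemma cont_on_integrable phi a b : cont_on phi a b ->
  (@lebesgue_measure R).-integrable `[a, b] (EFin \o phi).
Proof.
move=> h; apply: continuous_compact_integrable; first exact: segment_compact.
by apply: continuous_in_subspaceT => x; rewrite inE /= in_itv /=; apply: h.
Qed.

Lemma itg_split phi a m b : a <= m -> m <= b -> cont_on phi a b ->
  itg phi a b = itg phi a m + itg phi m b.
Proof.
move=> am mb /cont_on_integrable h; rewrite /itg.
rewrite -(@Rintegral_itv_obnd_cbnd R m (BRight b)); last first.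
  by apply: integrableS h => //; apply: subset_itvr; rewrite bnd_simp.
by rewrite -(@Rintegral_itvB R phi (BLeft a) (BRight b) m) ?bnd_simp // subrKC.
Qed.

Lemma itgD phi psi a b : cont_on phi a b -> cont_on psi a b ->
  itg (fun x => phi x + psi x) a b = itg phi a b + itg psi a b.
Proof. by move=> h1 h2; apply: RintegralD => //; apply: cont_on_integrable. Qed.

Lemma itg_cst k a b : a <= b -> itg (fun=> k) a b = k * (b - a).
Proof.
move=> ab; rewrite /itg Rintegral_cst //= lebesgue_measure_itv /= lte_fin.
by case: ltrP => // ba; rewrite (@le_anti _ _ a b) ?ab // subrr.
Qed.

Lemma le_itg phi k a b : a <= b -> cont_on phi a b ->
  (forall x, a <= x <= b -> phi x <= k) -> itg phi a b <= k * (b - a).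
Proof.
move=> ab h1 h2; rewrite -itg_cst //; apply: le_Rintegral.
- exact: measurable_itv.
- exact: cont_on_integrable.
- by apply: cont_on_integrable => x _; apply: cvg_cst.
- by move=> x /=; rewrite in_itv; apply: h2.
Qed.

Lemma itg_near phi k e a b : a <= b -> cont_on phi a b ->
  (forall x, a <= x <= b -> `|phi x - k| <= e) -> `|itg phi a b - k * (b - a)| <= e * (b - a).
Proof.
move=> ab h1 h2; rewrite ler_distl; apply/andP; split.
  rewrite -mulrBl -itg_cst //; apply: le_Rintegral.
  - exact: measurable_itv.
  - by apply: cont_on_integrable => x _; apply: cvg_cst.
  - exact: cont_on_integrable.
  - by move=> x /=; rewrite in_itv => /h2; rewrite ler_distl => /andP[].
rewrite -mulrDl; apply: le_itg => // x /h2; by rewrite ler_distl => /andP[].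
Qed.

Lemma lipschitz_at_continuous phi x K r : 0 < r ->
  (forall x', `|x' - x| < r -> `|phi x' - phi x| <= K * `|x' - x|) -> {for x, continuous phi}.
Proof.
move=> r0 h; apply/(@cvgrPdist_le _ R^o) => /= e e0.
have d0 : 0 < Num.min r (e / (`|K| + 1)) by rewrite lt_min r0 divr_gt0 // ltr_wpDl.
apply/nbhs_ballP; eexists; first exact: d0.
move=> t; rewrite /ball /=.
rewrite lt_min distrC => /andP[/h tr te]; rewrite distrC (le_trans tr) //.
rewrite (@le_trans _ _ ((`|K| + 1) * `|t - x|)) //.
  by rewrite ler_wpM2r // ler_wpDr // ler_norm.
by rewrite mulrC -ler_pdivlMr ?ltr_wpDl // ltW.
Qed.

(** Complex differentiability of u + i v at x + i y with derivative al + i be,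
    in real terms: Goursat's theorem then only needs integrals of real functions. *)
Definition cr_at (u v : R -> R -> R) x y := exists al be, forall e, 0 < e ->
  exists2 r, 0 < r & forall x' y', `|x' - x| < r -> `|y' - y| < r ->
   `|u x' y' - u x y - (al * (x' - x) - be * (y' - y))| <= e * (`|x' - x| + `|y' - y|) /\
   `|v x' y' - v x y - (be * (x' - x) + al * (y' - y))| <= e * (`|x' - x| + `|y' - y|).

Lemma cr_at_slices u v x y : cr_at u v x y ->
  {for x, continuous (u^~ y)} /\ {for y, continuous (v x)}.
Proof.
move=> [al [be /(_ 1 ltr01) [r r0 h]]]; split.
  apply: (@lipschitz_at_continuous _ _ (1 + `|al|) _ r0) => x' hx.
  have := h x' y hx; rewrite subrr normr0 => /(_ r0) [+ _].
  rewrite mulr0 subr0 addr0 mulrDl -normrM mul1r => k.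
  by rewrite -[X in `|X|](subrK (al * (x' - x))) (le_trans (ler_normD _ _)) // lerD2r.
apply: (@lipschitz_at_continuous _ _ (1 + `|al|) _ r0) => y' hy.
have := h x y'; rewrite subrr normr0 => /(_ r0 hy) [_].
rewrite mulr0 !add0r mulrDl -normrM mul1r => k.
by rewrite -[X in `|X|](subrK (al * (y' - y))) (le_trans (ler_normD _ _)) // lerD2r.
Qed.

(** The real part of the integral of (u + i v) dz along the boundary. Subtracting
    the affine part, whose contribution cancels, the integral over a small
    rectangle around a point is at most a small multiple of its squared
    perimeter; [quadrisection_eq0] concludes. *)
Lemma goursat_rectangle u v a b c d : a <= b -> c <= d ->
  (forall x y, a <= x <= b -> c <= y <= d -> cr_at u v x y) ->
  itg (fun x => u x c - u x d) a b = itg (fun y => v b y - v a y) c d.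
Proof.
move=> ab cd h.
have cu y : c <= y <= d -> cont_on (u^~ y) a b.
  by move=> hy x hx; case: (cr_at_slices _ _ _ _ (h x y hx hy)).
have cv x : a <= x <= b -> cont_on (v x) c d.
  by move=> hx y hy; case: (cr_at_slices _ _ _ _ (h x y hx hy)).
pose J a b c d := itg (fun x => u x c - u x d) a b - itg (fun y => v b y - v a y) c d.
suff : J a b c d = 0 by move/eqP; rewrite subr_eq0 => /eqP.
apply: quadrisection_eq0 => //.
- move=> a' m b' c' d' h1 h2 h3 h4 h5 h6 h7; rewrite /J.
  have ya : c <= c' <= d by rewrite h5 (le_trans h6).
  have yb : c <= d' <= d by rewrite h7 (le_trans h5).
  have am := le_trans h1 h2; have mb := le_trans h3 h4.
  rewrite (itg_split _ a' m b') //; last first.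
    by apply: cont_onB; apply: (cont_onW _ a b) => //; apply: cu.
  have -> : itg (fun y => v b' y - v a' y) c' d' =
    itg (fun y => v b' y - v m y) c' d' + itg (fun y => v m y - v a' y) c' d'.
    rewrite -itgD; first by apply: eq_Rintegral => y _; rewrite addrA subrK.
      apply: cont_onB; apply: (cont_onW _ c d) => //; apply: cv.
        by rewrite h4 (le_trans am).
      by rewrite am (le_trans h3).
    apply: cont_onB; apply: (cont_onW _ c d) => //; apply: cv.
      by rewrite am (le_trans h3).
    by rewrite h1 (le_trans h2).
  by rewrite opprD [- _ + - _]addrC addrACA.
- move=> a' b' c' m d' h1 h2 h3 h4 h5 h6 h7; rewrite /J.
  have xa : a <= a' <= b by rewrite h1 (le_trans h2).
  have xb : a <= b' <= b by rewrite h3 (le_trans h1).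
  have cm := le_trans h4 h5; have md := le_trans h6 h7.
  rewrite (itg_split _ c' m d') //; last first.
    by apply: cont_onB; apply: (cont_onW _ c d) => //; apply: cv.
  have -> : itg (fun x => u x c' - u x d') a' b' =
    itg (fun x => u x c' - u x m) a' b' + itg (fun x => u x m - u x d') a' b'.
    rewrite -itgD; first by apply: eq_Rintegral => y _; rewrite addrA subrK.
      apply: cont_onB; apply: (cont_onW _ a b) => //; apply: cu.
        by rewrite h4 (le_trans h5) // (le_trans h6).
      by rewrite cm (le_trans h6).
    apply: cont_onB; apply: (cont_onW _ a b) => //; apply: cu.
      by rewrite cm (le_trans h6).
    by rewrite h7 (le_trans h4 (le_trans h5 h6)).
  by rewrite opprD addrACA.
move=> x y e hx hy e0; have [al [be hab]] := h x y hx hy.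
have [r r0 hr] := hab _ (divr_gt0 e0 (ltr0n R 2)).
exists r => // a' b' c' d' h1 /andP[h2 h2'] h3 h4 /andP[h5 h5'] h6 br dr.
set S := b' - a' + (d' - c').
have ya : c <= c' <= d by rewrite h4 (le_trans h5) //; case/andP: hy.
have yb : c <= d' <= d by rewrite h6 andbT (le_trans _ h5') //; case/andP: hy.
have xa : a <= a' <= b by rewrite h1 (le_trans h2) //; case/andP: hx.
have xb : a <= b' <= b by rewrite h3 andbT (le_trans _ h2') //; case/andP: hx.
have dist (p q z w : R) : p <= z <= q -> p <= w <= q -> `|z - w| <= q - p.
  by clear; move=> /andP[? ?] /andP[? ?]; rewrite ler_norml; apply/andP; split; lra.
have xin : a' <= x <= b' by rewrite h2.
have yin : c' <= y <= d' by rewrite h5.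
have ca : c' <= c' <= d' by rewrite lexx (le_trans h5).
have da : c' <= d' <= d' by rewrite lexx (le_trans h5).
have aa : a' <= a' <= b' by rewrite lexx (le_trans h2).
have ba : a' <= b' <= b' by rewrite lexx (le_trans h2).
have near (x' y' : R) : a' <= x' <= b' -> c' <= y' <= d' ->
   `|u x' y' - u x y - (al * (x' - x) - be * (y' - y))| <= e / 2 * S /\
   `|v x' y' - v x y - (be * (x' - x) + al * (y' - y))| <= e / 2 * S.
  move=> hx' hy'.
  have dx := dist _ _ _ _ hx' xin; have dy := dist _ _ _ _ hy' yin.
  have [] := hr x' y' (le_lt_trans dx br) (le_lt_trans dy dr).
  have L : e / 2 * (`|x' - x| + `|y' - y|) <= e / 2 * S.
    by rewrite ler_pM2l ?divr_gt0 // lerD.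
  by split; apply: le_trans L.
(* both integrands are constant up to the error, and the two constants times
   the lengths agree: the affine part contributes nothing *)
have I1 : `|itg (fun x => u x c' - u x d') a' b' - be * (d' - c') * (b' - a')| <= e * S * (b' - a').
  apply: itg_near; first by case/andP: aa.
    by apply: cont_onB; apply: (cont_onW _ a b) => //; apply: cu.
  move=> x' hx'; have [n1 _] := near x' c' hx' ca; have [n2 _] := near x' d' hx' da.
  move: n1 n2; clear; rewrite !ler_norml => /andP[? ?] /andP[? ?]; apply/andP; split; lra.
have I2 : `|itg (fun y => v b' y - v a' y) c' d' - be * (b' - a') * (d' - c')| <= e * S * (d' - c').
  apply: itg_near; first by case/andP: ca.
    by apply: cont_onB; apply: (cont_onW _ c d) => //; apply: cv.
  move=> y' hy'; have [_ n1] := near b' y' ba hy'; have [_ n2] := near a' y' aa hy'.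
  move: n1 n2; clear; rewrite !ler_norml => /andP[? ?] /andP[? ?]; apply/andP; split; lra.
have -> : e * S ^+ 2 = e * S * (b' - a') + e * S * (d' - c') by rewrite -mulrDr -/S -mulrA.
rewrite /J.
move: I1 I2; rewrite [be * (d' - c') * _]mulrAC.
set A := itg _ _ _; set B := itg _ _ _; set X := be * _ * _; move=> I1 I2.
rewrite -[A - B](_ : (A - X) - (B - X) = _); last by rewrite opprB addrA subrK.
by rewrite (le_trans (ler_normB _ _)) // lerD.
Qed.

End Goursat.

(** * Complex differentiability and the exponential *)

Section NumFieldDerivable.
Variable K : numFieldType.
Implicit Types (F G : K -> K) (z : K).

Definition cderivable F z := derivable (F : K^o -> K^o) (z : K^o) 1.

Lemma cderivableD F G z : cderivable F z -> cderivable G z -> cderivable (fun w => F w + G w) z.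
Proof. exact: derivableD. Qed.
Lemma cderivableM F G z : cderivable F z -> cderivable G z -> cderivable (fun w => F w * G w) z.
Proof. exact: derivableM. Qed.
Lemma cderivableN F z : cderivable F z -> cderivable (fun w => - F w) z.
Proof. exact: derivableN. Qed.
Lemma cderivableV F z : F z != 0 -> cderivable F z -> cderivable (fun w => (F w)^-1) z.
Proof. exact: derivableV. Qed.
Lemma cderivable_id z : cderivable (fun w => w) z.
Proof. exact: derivable_id. Qed.
Lemma cderivable_cst c z : cderivable (fun=> c) z.
Proof. exact: derivable_cst. Qed.
Lemma cderivable_comp F G z : cderivable F z -> cderivable G (F z) -> cderivable (fun w => G (F w)) z.
Proof.
move=> /derivable1_diffP a /derivable1_diffP b; apply/derivable1_diffP.
exact: differentiable_comp.
Qed.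
Lemma cderivable_cont F z : cderivable F z -> {for (z : K^o), continuous (F : K^o -> K^o)}.
Proof. by move=> /derivable1_diffP a; exact: differentiable_continuous. Qed.

End NumFieldDerivable.

Section ComplexBasics.
Variable R : realType.
Notation C := R[i].
Implicit Types (x y r e : R).

Section Modulus.
Implicit Types z w : C.

Lemma cmod_ge0 z : 0 <= cmod z.
Proof. by case: z => a b; rewrite /cmod /= sqrtr_ge0. Qed.
Lemma cmod0 : cmod (0 : C) = 0.
Proof. exact: Normc.normc0. Qed.
Lemma cmod1 : cmod (1 : C) = 1.
Proof. exact: Normc.normc1. Qed.
Lemma cmodM z w : cmod (z * w) = cmod z * cmod w.
Proof. exact: Normc.normcM. Qed.
Lemma cmodV z : cmod z^-1 = (cmod z)^-1.
Proof. exact: Normc.normcV. Qed.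
Lemma cmodN z : cmod (- z) = cmod z.
Proof. exact: normcN. Qed.
Lemma cmodD z w : cmod (z + w) <= cmod z + cmod w.
Proof. exact: le_normcD. Qed.
Lemma cmodB z w : cmod (z - w) <= cmod z + cmod w.
Proof. by rewrite -(cmodN w) cmodD. Qed.
Lemma cmod_distC z w : cmod (z - w) = cmod (w - z).
Proof. by rewrite -cmodN opprB. Qed.
Lemma cmod_eq0 z : (cmod z == 0) = (z == 0).
Proof. by apply/eqP/eqP => [/Normc.eq0_normc | ->] //; rewrite cmod0. Qed.
Lemma cmod_gt0 z : (0 < cmod z) = (z != 0).
Proof. by rewrite lt_neqAle cmod_ge0 andbT eq_sym cmod_eq0. Qed.
Lemma cmodX z n : cmod (z ^+ n) = cmod z ^+ n.
Proof. by elim: n => [|n IH]; rewrite ?expr0 ?cmod1 // !exprS cmodM IH. Qed.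
Lemma cmod_real x : cmod (x%:C) = `|x|.
Proof. by rewrite /cmod /= expr0n /= addr0 sqrtr_sqr. Qed.
Lemma cmod_sqr z : cmod z ^+ 2 = Re z ^+ 2 + Im z ^+ 2.
Proof. by case: z => a b; rewrite /cmod /= sqr_sqrtr // addr_ge0 // sqr_ge0. Qed.
Lemma Re_le_cmod z : `|Re z| <= cmod z.
Proof.
by rewrite -(@ler_pXn2r _ 2) ?nnegrE ?cmod_ge0 // cmod_sqr real_normK ?num_real // lerDl sqr_ge0.
Qed.
Lemma Im_le_cmod z : `|Im z| <= cmod z.
Proof.
by rewrite -(@ler_pXn2r _ 2) ?nnegrE ?cmod_ge0 // cmod_sqr real_normK ?num_real // lerDr sqr_ge0.
Qed.
Lemma cmod_le_ReIm z : cmod z <= `|Re z| + `|Im z|.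
Proof.
rewrite -(@ler_pXn2r _ 2) ?nnegrE ?cmod_ge0 ?addr_ge0 // cmod_sqr sqrrD !real_normK ?num_real //.
by rewrite addrAC lerDl mulrn_wge0 // mulr_ge0.
Qed.
Lemma cmod_conj z : cmod (z^*) = cmod z.
Proof. by case: z => a b; rewrite /cmod /= sqrrN. Qed.
Lemma cmod_prod I (s : seq I) (F : I -> C) : cmod (\prod_(i <- s) F i) = \prod_(i <- s) cmod (F i).
Proof. by elim/big_rec2: _ => [|i a b _ <-]; rewrite ?cmod1 // cmodM. Qed.
Lemma ReD z w : Re (z + w) = Re z + Re w. Proof. by case: z; case: w. Qed.
Lemma ReN z : Re (- z) = - Re z. Proof. by case: z. Qed.
Lemma ReM z w : Re (z * w) = Re z * Re w - Im z * Im w. Proof. by case: z; case: w. Qed.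
Lemma ImD z w : Im (z + w) = Im z + Im w. Proof. by case: z; case: w. Qed.
Lemma ImN z : Im (- z) = - Im z. Proof. by case: z. Qed.
Lemma ImM z w : Im (z * w) = Re z * Im w + Im z * Re w. Proof. by case: z; case: w. Qed.
Lemma Re_sum I (s : seq I) (P : pred I) (F : I -> C) :
  Re (\sum_(i <- s | P i) F i) = \sum_(i <- s | P i) Re (F i).
Proof. by elim/big_rec2: _ => [|i a b _ <-] //; rewrite ReD. Qed.
Lemma Re_realM x z : Re (x%:C * z) = x * Re z.
Proof. by rewrite ReM /= mul0r subr0. Qed.
Lemma cmod_dist_le z w : `|cmod z - cmod w| <= cmod (z - w).
Proof.
rewrite ler_norml; apply/andP; split.
  by rewrite lerNl opprB lerBlDr cmod_distC -{1}(subrK z w) cmodD.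
by rewrite lerBlDr -{1}(subrK w z) cmodD.
Qed.

End Modulus.

Lemma nbhs_cmod (P : set (C^o)) (z : C^o) :
  nbhs z P <-> exists2 r, 0 < r & forall w, cmod (w - z) < r -> P w.
Proof.
split.
  move=> /nbhs_ballP [e /= e0 h].
  case: e e0 h => e i; rewrite ltcE /= => /andP[/eqP -> e0] h.
  exists e => // w hw; apply: h; rewrite /ball /= ltcE /= eqxx /=.
  by rewrite -/(cmod _) cmod_distC.
move=> [r r0 h]; apply/nbhs_ballP; exists (r%:C); first by rewrite /= ltcE /= eqxx.
move=> w; rewrite /ball /= ltcE /= => /andP[_ hw]; apply: h.
by rewrite cmod_distC.
Qed.

Lemma cvg_cmodP (F : C^o -> C^o) (z : C^o) : {for z, continuous F} <->
  forall e, 0 < e -> exists2 r, 0 < r & forall w, cmod (w - z) < r -> cmod (F w - F z) < e.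
Proof.
split=> [h e e0|h].
  have /h /nbhs_cmod : nbhs (F z) [set w : C^o | cmod (w - F z) < e].
    by apply/nbhs_cmod; exists e.
  by [].
move=> P /nbhs_cmod [e e0 he]; apply/nbhs_cmod.
by have [r r0 hr] := h e e0; exists r => // w /hr /he.
Qed.

Definition hol (F : C -> C) (z : C) := derivable (F : C^o -> C^o) (z : C^o) 1.

(** The error form of differentiability, in which all bounds are real. *)
Lemma holP (F : C -> C) (z : C) : hol F z <-> exists l : C, forall e, 0 < e ->
  exists2 r, 0 < r & forall w, cmod (w - z) < r ->
    cmod (F w - F z - l * (w - z)) <= e * cmod (w - z).
Proof.
split.
  move=> /cvg_ex [/= l hl]; exists l => e e0.
  have /hl /nbhs_cmod [r r0 hr] : nbhs (l : C^o) [set w : C^o | cmod (w - l) < e].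
    by apply/nbhs_cmod; exists e.
  exists r => // w hw; have [-> | wz] := eqVneq w z.
    by rewrite !subrr mulr0 subr0 cmod0 mulr0.
  have := hr (w - z); rewrite subr0 subr_eq0 => /(_ hw wz) /=.
  rewrite /GRing.scale /= mulr1 subrK => {}hw.
  have wz0 : w - z != 0 by rewrite subr_eq0.
  have -> : F w - F z - l * (w - z) = ((w - z)^-1 * (F w - F z) - l) * (w - z).
    by rewrite mulrBl mulrAC mulVf // mul1r.
  by rewrite cmodM ler_wpM2r ?cmod_ge0 // ltW.
move=> [l hl]; apply/cvg_ex; exists l => P /nbhs_cmod [e e0 he].
have [r r0 hr] := hl _ (divr_gt0 e0 (ltr0n R 2)).
apply/nbhs_cmod; exists r => // h; rewrite subr0 => hh h0 /=; apply: he.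
have h0' : 0 < cmod h by rewrite cmod_gt0.
have := hr (h + z); rewrite addrK /GRing.scale /= mulr1 => /(_ hh) hd.
have -> : h^-1 * (F (h + z) - F z) - l = h^-1 * (F (h + z) - F z - l * h).
  by rewrite [RHS]mulrBr [l * h]mulrC mulKf.
rewrite cmodM cmodV mulrC ltr_pdivrMr // (le_lt_trans hd) // ltr_pM2r //.
by rewrite ltr_pdivrMr // ltr_pMr // ltr1n.
Qed.

Section HolRules.
Implicit Types (F G : C -> C).

Lemma hol_cont F (z : C) : hol F z -> {for (z : C^o), continuous (F : C^o -> C^o)}.
Proof. exact: (@cderivable_cont C). Qed.
Lemma holD F G (z : C) : hol F z -> hol G z -> hol (fun w => F w + G w) z.
Proof. exact: (@cderivableD C). Qed.
Lemma holM F G (z : C) : hol F z -> hol G z -> hol (fun w => F w * G w) z.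
Proof. exact: (@cderivableM C). Qed.
Lemma holN F (z : C) : hol F z -> hol (fun w => - F w) z.
Proof. exact: (@cderivableN C). Qed.
Lemma holV F (z : C) : F z != 0 -> hol F z -> hol (fun w => (F w)^-1) z.
Proof. exact: (@cderivableV C). Qed.
Lemma hol_id (z : C) : hol (fun w => w) z.
Proof. exact: (@cderivable_id C). Qed.
Lemma hol_cst (c z : C) : hol (fun=> c) z.
Proof. exact: (@cderivable_cst C). Qed.
Lemma hol_comp F G (z : C) : hol F z -> hol G (F z) -> hol (fun w => G (F w)) z.
Proof. exact: (@cderivable_comp C). Qed.
Lemma hol_sum I (s : seq I) (F : I -> C -> C) (z : C) :
  (forall i, hol (F i) z) -> hol (fun w => \sum_(i <- s) F i w) z.
Proof.
move=> h; elim: s => [|i s IH].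
  have -> : (fun w => \sum_(i <- [::]) F i w) = fun=> 0 by apply: funext => w; rewrite big_nil.
  exact: hol_cst.
have -> : (fun w => \sum_(i <- i :: s) F i w) = fun w => F i w + \sum_(i <- s) F i w.
  by apply: funext => w; rewrite big_cons.
exact: (holD _ _ _ (h i) IH).
Qed.
Lemma hol_prod I (s : seq I) (F : I -> C -> C) (z : C) :
  (forall i, hol (F i) z) -> hol (fun w => \prod_(i <- s) F i w) z.
Proof.
move=> h; elim: s => [|i s IH].
  have -> : (fun w => \prod_(i <- [::]) F i w) = fun=> 1 by apply: funext => w; rewrite big_nil.
  exact: hol_cst.
have -> : (fun w => \prod_(i <- i :: s) F i w) = fun w => F i w * \prod_(i <- s) F i w.
  by apply: funext => w; rewrite big_cons.
exact: (holM _ _ _ (h i) IH).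
Qed.
Lemma holX F n (z : C) : hol F z -> hol (fun w => F w ^+ n) z.
Proof.
move=> h; elim: n => [|n IH]; first exact: hol_cst.
have -> : (fun w => F w ^+ n.+1) = fun w => F w * F w ^+ n by apply: funext => w; rewrite exprS.
exact: (holM _ _ _ h IH).
Qed.
(** Complex differentiability is local, so that functions defined by cases can be
    handled. *)
Lemma hol_near (F G : C -> C) (z : C) r : 0 < r ->
  (forall w, cmod (w - z) < r -> F w = G w) -> hol F z -> hol G z.
Proof.
by move=> r0 h; apply: near_eq_derivable; apply/nbhs_cmod; exists r.
Qed.

End HolRules.

Definition cexp (z : C) : C := expR (Re z) * cos (Im z) +i* (expR (Re z) * sin (Im z)).

Section Exp.
Implicit Types z w : C.

Lemma cexp0 : cexp 0 = 1.
Proof. by rewrite /cexp /= expR0 cos0 sin0 mul1r mulr0. Qed.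
Lemma cexpD z w : cexp (z + w) = cexp z * cexp w.
Proof.
rewrite /cexp ReD ImD expRD cosD sinD.
by apply/eqP; rewrite eq_complex /=; apply/andP; split; apply/eqP; ring.
Qed.
Lemma cmod_cexp z : cmod (cexp z) = expR (Re z).
Proof.
have h : 0 <= cmod (cexp z) := cmod_ge0 _.
apply/eqP; rewrite -(@eqrXn2 _ 2) ?expR_ge0 // cmod_sqr /cexp /= !exprMn -mulrDr.
by rewrite cos2Dsin2 mulr1.
Qed.

End Exp.

Lemma is_derive_small (f : R -> R) (x l e : R) : is_derive x 1 f l -> 0 < e ->
  exists2 r, 0 < r & forall h, `|h| < r -> `|f (h + x) - f x - l * h| <= e * `|h|.
Proof.
move=> [/cvg_ex [/= l' hl] dl] e0.
have E : l' = l by rewrite -dl; apply/esym/cvg_lim.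
rewrite {}E in hl.
have : nbhs l [set w : R | `|w - l| < e].
  by apply/nbhs_ballP; exists e => //= w; rewrite /ball /= distrC.
move=> /hl /nbhs_ballP [r /= r0 hr].
exists r => // h hh; have [-> | h0] := eqVneq h 0.
  by rewrite add0r subrr mulr0 subr0 normr0 mulr0.
have := hr h; rewrite /ball /= sub0r normrN => /(_ hh h0) /=.
rewrite /GRing.scale /= mulr1 => {}hh.
have -> : f (h + x) - f x - l * h = (h^-1 * (f (h + x) - f x) - l) * h.
  by rewrite mulrBl mulrAC mulVf // mul1r.
by rewrite normrM ler_wpM2r // ltW.
Qed.

Lemma hol_cexp (z : C) : hol cexp z.
Proof.
suff : hol cexp 0.
  move=> h; have -> : cexp = fun w => cexp z * cexp (w - z).
    by apply: funext => w; rewrite -cexpD subrKC.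
  apply: holM; first exact: hol_cst.
  apply: hol_comp; first by apply: holD; [apply: hol_id | apply: hol_cst].
  by rewrite subrr.
apply/holP; exists 1 => e e0.
have e4 : 0 < Num.min (e / 9) 1 by rewrite lt_min ltr01 divr_gt0.
set e' := Num.min _ _ in e4.
have e'1 : e' <= 1 by rewrite /e' ge_min lexx orbT.
have e'4 : e' <= e / 9 by rewrite /e' ge_min lexx.
clearbody e'.
have [r1 r10 h1] := is_derive_small expR 0 _ e' (is_derive_expR 0) e4.
have [r2 r20 h2] := is_derive_small sin 0 _ e' (is_derive_sin 0) e4.
have [r3 r30 h3] := is_derive_small cos 0 _ e' (is_derive_cos 0) e4.
rewrite expR0 in h1; rewrite sin0 cos0 in h2; rewrite sin0 cos0 in h3.
exists (Num.min (Num.min r1 r2) (Num.min r3 e')).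
  by rewrite !lt_min r10 r20 r30 e4.
move=> [x y]; rewrite subr0 cexp0 mul1r !lt_min => /andP[/andP[c1 c2] /andP[c3 c4]].
have xm : `|x| <= cmod (x +i* y) := Re_le_cmod (x +i* y).
have ym : `|y| <= cmod (x +i* y) := Im_le_cmod (x +i* y).
have {}h1 := h1 x (le_lt_trans xm c1).
have {}h2 := h2 y (le_lt_trans ym c2).
have {}h3 := h3 y (le_lt_trans ym c3).
have x4 := le_lt_trans xm c4; have y4 := le_lt_trans ym c4.
move: h1 h2 h3; rewrite !addr0 !mul1r oppr0 mul0r !subr0 addr0 => h1 h2 h3.
clear c1 c2 c3 c4; move: (cmod (x +i* y)) xm ym => m xm ym.
apply: (le_trans (cmod_le_ReIm _)); rewrite /cexp /= oppr0 !addr0.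
have hx : `|expR x - 1| <= 2 * `|x|.
  rewrite -(subrK x (expR x - 1)) (le_trans (ler_normD _ _)) // mulr2n mulrDl mul1r lerD2r.
  by rewrite (le_trans h1) // ler_piMl.
have hE : `|expR x| <= 3.
  rewrite -(subrK 1 (expR x)) (le_trans (ler_normD _ _)) // normr1.
  have : 2 * `|x| <= 2 by rewrite ler_piMr // (le_trans (ltW x4)).
  by move: hx; lra.
have hRe : `|expR x * cos y - 1 - x| <= e' * (3 * `|y| + `|x|).
  have -> : expR x * cos y - 1 - x = expR x * (cos y - 1) + (expR x - 1 - x) by ring.
  rewrite (le_trans (ler_normD _ _)) // [leRHS]mulrDr lerD // normrM mulrCA.
  by rewrite ler_pM.
have hIm : `|expR x * sin y - y| <= e' * (3 * `|y| + 2 * `|x|).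
  have -> : expR x * sin y - y = expR x * (sin y - y) + (expR x - 1) * y by ring.
  rewrite (le_trans (ler_normD _ _)) // [leRHS]mulrDr lerD // normrM.
    by rewrite mulrCA ler_pM.
  by rewrite [e' * _]mulrC; apply: ler_pM => //; apply: ltW.
apply: le_trans (lerD hRe hIm) _.
rewrite (_ : e * m = (e / 9) * (9 * m)); last by field.
by rewrite -mulrDr ler_pM ?(ltW e4) //; lra.
Qed.

End ComplexBasics.

(** * The maximum principle *)

Section MaximumPrinciple.
Variable R : realType.
Notation C := R[i].
Implicit Types (x y r e : R) (F : C -> C).

Lemma hol_cr F x y : hol R F (x +i* y) ->
  cr_at R (fun x y => Re (F (x +i* y))) (fun x y => Im (F (x +i* y))) x y.
Proof.
move=> /holP [l hl]; exists (Re l), (Im l) => e e0.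
have [r r0 hr] := hl e e0; exists (r / 2); first by rewrite divr_gt0.
move=> x' y' hx hy.
have D : cmod ((x' - x) +i* (y' - y)) <= `|x' - x| + `|y' - y| by apply: cmod_le_ReIm.
have /hr : cmod ((x' +i* y') - (x +i* y)) < r.
  by rewrite (le_lt_trans D) // [ltRHS](splitr r) ltrD.
move=> H.
have {}H : cmod (F (x' +i* y') - F (x +i* y) - l * ((x' - x) +i* (y' - y))) <= e * (`|x' - x| + `|y' - y|).
  by rewrite (le_trans H) // ler_pM2l.
split; apply: le_trans H.
  by apply: le_trans (Re_le_cmod _ _); rewrite !ReD !ReN ReM.
by apply: le_trans (Im_le_cmod _ _); rewrite !ImD !ImN ImM /= [Im l * _ + _]addrC.
Qed.

(** If |F| were smaller than m = |F(z0)| on the whole circle, then, after a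
    rotation c making c F(z0) = i m, the imaginary part v of
    w |-> c F(z0 + exp w) would stay below m by a fixed amount at x = ln rho and
    be as close to m as desired for x near -oo. Goursat's theorem on
    [a, ln rho] x [0, 2 pi], where the horizontal sides cancel by periodicity,
    says that the integrals of v over the two vertical sides are equal. *)
Lemma circle_attains F z0 rho : 0 < rho -> (forall w, cmod (w - z0) <= rho -> hol R F w) ->
  exists2 z, cmod (z - z0) = rho & cmod (F z0) <= cmod (F z).
Proof.
move=> rho0 hF; apply: contrapT => H.
have lt z : cmod (z - z0) = rho -> cmod (F z) < cmod (F z0).
  by move=> hz; rewrite ltNge; apply/negP => h; apply: H; exists z.
set m := cmod (F z0) in lt.
have Cr : cmod (rho%:C) = rho by rewrite cmod_real gtr0_norm.
have m0 : 0 < m.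
  by apply: le_lt_trans (lt (z0 + rho%:C) _); rewrite ?cmod_ge0 // addrC addKr.
pose c : C := (Im (F z0) / m) +i* (Re (F z0) / m).
have cm : cmod c = 1.
  have h : 0 <= cmod c := cmod_ge0 _ _.
  apply/eqP; rewrite -(@eqrXn2 _ 2) // cmod_sqr expr1n /c /= !expr_div_n -mulrDl addrC.
  by rewrite -cmod_sqr divff // expf_neq0 // gt_eqF.
have cF : Im (c * F z0) = m.
  rewrite ImM /c /= [_ / m * Im _]mulrAC [_ / m * Re _]mulrAC -mulrDl -!expr2 addrC.
  by rewrite -cmod_sqr expr2 mulfK // gt_eqF.
pose zz x y := z0 + cexp R (x +i* y).
have zd x y : cmod (zz x y - z0) = expR x by rewrite /zz addrC addKr cmod_cexp.
pose G (w : C) : C := c * F (z0 + cexp R w).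
pose u x y := Re (G (x +i* y)); pose v x y := Im (G (x +i* y)).
have cr x y : x <= ln rho -> cr_at R u v x y.
  move=> hx; apply: hol_cr; apply: holM; first exact: hol_cst.
  apply: (hol_comp R (fun w => z0 + cexp R w) F).
    by apply: holD; [apply: hol_cst | apply: hol_cexp].
  by apply: hF; rewrite -/(zz x y) zd -[leRHS](lnK rho0) ler_expR.
set b := ln rho in cr.
have vlt y : v b y < m.
  rewrite /v /G (le_lt_trans (ler_norm _)) // (le_lt_trans (Im_le_cmod _ _)) //.
  by rewrite cmodM cm mul1r lt // -/(zz b y) zd /b lnK.
have pi2 : 0 <= 2 * pi :> R by rewrite mulr_ge0 // pi_ge0.
have [ys hys vmax] : exists2 c, c \in `[0, 2 * pi]%R & forall t, t \in `[0, 2 * pi]%R -> v b t <= v b c.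
  apply: EVT_max => //; apply: continuous_in_subspaceT => y _.
  by case: (cr_at_slices _ _ _ _ _ (cr b y (lexx _))).
set eta := (m - v b ys) / 2.
have eta0 : 0 < eta by rewrite divr_gt0 // subr_gt0.
have [d d0 hd] : exists2 r, 0 < r & forall w, cmod (w - z0) < r -> cmod (F w - F z0) < eta.
  have /cvg_cmodP : {for (z0 : C^o), continuous (F : C^o -> C^o)}.
    by apply: hol_cont; apply: hF; rewrite subrr cmod0 ltW.
  exact.
pose a := Num.min b (ln (d / 2)).
have ab : a <= b by rewrite ge_min lexx.
have vgt y : m - eta <= v a y.
  have : cmod (F (zz a y) - F z0) < eta.
    apply: hd; rewrite zd; apply: (@le_lt_trans _ _ (d / 2)).
      by rewrite -[leRHS]lnK ?posrE ?divr_gt0 // ler_expR ge_min lexx orbT.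
    by rewrite ltr_pdivrMr // ltr_pMr // ltr1n.
  rewrite -[cmod _]mul1r -cm -cmodM => /ltW.
  move=> /(le_trans (Im_le_cmod _ _)); rewrite mulrBr ImD ImN cF ler_norml => /andP[].
  by rewrite lerBrDr addrC.
have per : itg R (fun x => u x 0 - u x (2 * pi)) a b = 0.
  have -> : (fun x => u x 0 - u x (2 * pi)) = fun=> 0.
    by apply: funext => x; rewrite /u /G /cexp /= cos0 sin0 mulr_natl cos2pi sin2pi subrr.
  by rewrite itg_cst // mul0r.
have := goursat_rectangle R u v a b 0 (2 * pi) ab pi2.
rewrite per => vint; have {}vint : itg R (fun y => v b y - v a y) 0 (2 * pi) = 0.
  by apply/esym/vint => x y /andP[_ xb] _; apply: cr.
have : itg R (fun y => v b y - v a y) 0 (2 * pi) <= (- eta) * (2 * pi - 0).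
  apply: le_itg => //.
    move=> y _; apply: cvgB.
      by case: (cr_at_slices _ _ _ _ _ (cr b y (lexx _))).
    by case: (cr_at_slices _ _ _ _ _ (cr a y ab)).
  move=> y hy; have := vmax y; rewrite in_itv /= => /(_ hy) h1.
  have h2 := vgt y; have E : eta + eta = m - v b ys by rewrite /eta -splitr.
  by move: h1 h2 E; clear; lra.
rewrite vint subr0 mulNr oppr_ge0 leNgt mulr_gt0 // mulr_gt0 //; exact: pi_gt0.
Qed.

Lemma continuous_cmod_at (F : C^o -> C^o) (z : C^o) : {for z, continuous F} ->
  {for z, continuous (fun w => cmod (F w))}.
Proof.
move=> /cvg_cmodP h P /nbhs_ballP [e /= e0 he]; have [r r0 hr] := h e e0.
apply/nbhs_cmod; exists r => // w /hr hw; apply: he; rewrite /ball /= distrC.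
exact: le_lt_trans (cmod_dist_le _ _ _) hw.
Qed.

Definition toC (p : R * R) : C^o := p.1 +i* p.2.

Lemma continuous_toC : continuous toC.
Proof.
move=> p P /nbhs_cmod [r r0 hr]; apply/nbhs_ballP; exists (r / 2); first by rewrite /= divr_gt0.
move=> q [/= h1 h2]; apply: hr; rewrite /ball /= in h1 h2.
apply: le_lt_trans (cmod_le_ReIm _ _) _; rewrite [r]splitr ltrD //=; by rewrite distrC.
Qed.

(** The region is {|z| <= r, W z >= y}; only the part of its boundary on which
    |z| = r or W z = y matters, the other points being interior. At an interior
    maximum z0 of |F(z)| exp (e |z|^2), compare F with the holomorphic function
    F(z) exp (2 e conj(z0) z): since
    |z|^2 = 2 Re (conj(z0) z) - |z0|^2 + |z - z0|^2, a point of a small circle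
    around z0 given by [circle_attains] would beat z0 by exp (e rho^2). *)
Lemma maximum_principle F (W : C^o -> R) r y : r < 1 ->
  (forall z, cmod z < 1 -> hol R F z) -> continuous W ->
  (forall z, cmod z <= r -> y <= W z -> cmod z = r \/ W z = y -> cmod (F z) <= 1) ->
  forall z, cmod z <= r -> y <= W z -> cmod (F z) <= 1.
Proof.
move=> r1 hF cW bd z zr yz.
suff main e : 0 < e -> cmod (F z) <= expR e.
  apply/ler_addgt0Pr => e e0; have h := main (ln (1 + e)).
  have e1 : 0 < 1 + e by rewrite addr_gt0.
  by rewrite lnK // in h; apply: h; rewrite ln_gt0 // ltrDl.
move=> e0.
pose K := [set p | cmod (toC p) <= r /\ y <= W (toC p)].
pose phi p := cmod (F (toC p)) * expR (e * cmod (toC p) ^+ 2).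
have cmodC : continuous (fun w : C^o => cmod w).
  by move=> w; apply: (continuous_cmod_at (fun w => w)); apply: cvg_id.
have cK : compact K.
  apply: (@subclosed_compact _ K ((`[-1, 1] : set R) `*` (`[-1, 1] : set R))).
  - have -> : K = (fun p => cmod (toC p)) @^-1` [set x | x <= r] `&` (fun p => W (toC p)) @^-1` [set x | y <= x].
      by [].
    apply: closedI; apply: closed_comp => [p _|]; [|exact: closed_le| |exact: closed_ge].
      by apply: (@continuous_comp _ _ _ toC (fun w : C^o => cmod w)); [apply: continuous_toC | apply: cmodC].
    by apply: (@continuous_comp _ _ _ toC W); [apply: continuous_toC | apply: cW].
  - by apply: compact_setX; apply: segment_compact.
  - move=> [a b] [h _]; have h1 : cmod (a +i* b : C) <= 1 := le_trans h (ltW r1).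
    have ha := le_trans (Re_le_cmod R (a +i* b)) h1.
    have hb := le_trans (Im_le_cmod R (a +i* b)) h1.
    by rewrite /= !in_itv /= -!ler_norml.
have K0 : K !=set0.
  by exists (Re z, Im z); rewrite /K /toC /=; case: z zr yz => a b.
have [[a b] hc hmax] : exists2 c, c \in K & forall t, t \in K -> phi t <= phi c.
  apply: compact_EVT_max => //; apply: continuous_in_subspaceT => p; rewrite inE => -[h _].
  apply: cvgM.
    apply: (@continuous_comp _ _ _ toC (fun w : C^o => cmod (F w))); first exact: continuous_toC.
    by apply: (continuous_cmod_at F); apply: hol_cont; apply: hF; apply: le_lt_trans h r1.
  apply: (@continuous_comp _ _ _ toC (fun w : C^o => expR (e * cmod w ^+ 2))); first exact: continuous_toC.
  apply: (@continuous_comp _ _ _ (fun w : C^o => cmod w) (fun x : R => expR (e * x ^+ 2))); first exact: cmodC.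
  apply: (@continuous_comp _ _ _ (fun x : R => e * x ^+ 2) expR); last exact: continuous_expR.
  apply: (@continuous_comp _ _ _ (fun x : R => x ^+ 2) (fun x : R => e * x)); last exact: mulrl_continuous.
  exact: exprn_continuous.
set z0 : C := a +i* b.
move: hc; rewrite inE => -[]; rewrite /toC /= -/z0 => z0r yz0.
have {}hmax w : cmod w <= r -> y <= W w ->
    cmod (F w) * expR (e * cmod w ^+ 2) <= cmod (F z0) * expR (e * cmod z0 ^+ 2).
  case: w => p q h1 h2; have := hmax (p, q); rewrite inE; apply; split => //.
have z1 : cmod z <= 1 := le_trans zr (ltW r1).
have z01 : cmod z0 <= 1 := le_trans z0r (ltW r1).
have fin : cmod (F z0) <= 1 -> cmod (F z) <= expR e.
  move=> h; apply: (@le_trans _ _ (cmod (F z) * expR (e * cmod z ^+ 2))).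
    by rewrite ler_peMr ?cmod_ge0 // -expR0 ler_expR mulr_ge0 ?sqr_ge0 // ltW.
  apply: (le_trans (hmax z zr yz)); rewrite -[leRHS]mul1r ler_pM ?cmod_ge0 ?expR_ge0 //.
  by rewrite ler_expR ger_pMr // exprn_ile1 // cmod_ge0.
have [z0e|z0r'] := eqVneq (cmod z0) r; first by apply: fin; apply: bd => //; left.
have [We|yz0'] := eqVneq (W z0) y; first by apply: fin; apply: bd => //; right.
have {}z0r' : cmod z0 < r by rewrite lt_neqAle z0r'.
have {}yz0' : y < W z0 by rewrite lt_neqAle eq_sym yz0'.
have [F0|F0] := eqVneq (F z0) 0; first by apply: fin; rewrite F0 cmod0.
exfalso.
have [d d0 hd] : exists2 d, 0 < d & forall w, cmod (w - z0) < d -> y < W w.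
  apply/nbhs_cmod; apply: (cW z0 [set x | y < x]).
  apply/nbhs_ballP; exists (W z0 - y); first by rewrite /= subr_gt0.
  by move=> t; rewrite /ball /= ltr_distlC subKr => /andP[].
pose rho := Num.min (d / 2) ((r - cmod z0) / 2).
have rho0 : 0 < rho by rewrite lt_min !divr_gt0 // subr_gt0.
have rhod : rho < d.
  by rewrite gt_min ltr_pdivrMr // ltr_pMr // ltr1n.
have rhor : rho <= r - cmod z0.
  by rewrite ge_min [X in _ || X]ler_pdivrMr ?ltr0n // ler_peMr ?orbT ?ler1n // subr_ge0.
pose G (w : C) : C := F w * cexp R ((2 * e)%:C * z0^* * w).
have [w hw hG] : exists2 w, cmod (w - z0) = rho & cmod (G z0) <= cmod (G w).
  apply: circle_attains => // w hw; apply: holM.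
    apply: hF; apply: le_lt_trans r1.
    by rewrite -(subrK z0 w) (le_trans (cmodD _ _ _)) // -lerBrDr (le_trans hw).
  apply: (hol_comp R (fun w => (2 * e)%:C * z0^* * w) (cexp R)); last exact: hol_cexp.
  by apply: holM; [apply: hol_cst | apply: hol_id].
have wr : cmod w <= r.
  by rewrite -(subrK z0 w) (le_trans (cmodD _ _ _)) // -lerBrDr hw.
pose P0 := Re ((2 * e)%:C * z0^* * z0); pose Pw := Re ((2 * e)%:C * z0^* * w).
have h1 : cmod (F z0) * expR P0 <= cmod (F w) * expR Pw.
  by move: hG; rewrite /G !cmodM !cmod_cexp.
pose s := - e * cmod z0 ^+ 2; pose t := e * rho ^+ 2.
have E0 : e * cmod z0 ^+ 2 = P0 + s by rewrite /P0 /s cmod_sqr /z0 /=; ring.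
have Ew : e * cmod w ^+ 2 = Pw + s + t.
  by rewrite /P0 /Pw /s /t -hw !cmod_sqr; case: (w) => p q /=; rewrite /z0 /=; ring.
have h3 : 1 < expR t by rewrite -expR0 ltr_expR mulr_gt0 // exprn_gt0.
have h2 : cmod (F w) * expR Pw * expR s * expR t <= cmod (F z0) * expR P0 * expR s.
  have hwd : cmod (w - z0) < d by rewrite hw.
  move: (hmax w wr (ltW (hd w hwd))); rewrite E0 Ew; clearbody P0 Pw s t.
  by rewrite !expRD !mulrA.
have key (a' b' S T : R) : 0 < a' -> 0 < S -> 1 < T -> a' <= b' -> b' * S * T <= a' * S -> False.
  move=> a0 S0 T1 ab; apply/negP; rewrite -ltNge.
  rewrite mulrAC ltr_pM2r //; apply: lt_le_trans (ler_wpM2r _ ab); first by rewrite ltr_pMr.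
  by rewrite ltW // (lt_trans _ T1).
apply: (key _ _ _ _ _ _ h3 h1 h2); last exact: expR_gt0.
by apply: mulr_gt0; [rewrite cmod_gt0 | exact: expR_gt0].
Qed.

End MaximumPrinciple.

(** * Counting zeros by the maximum principle *)

Section Zeros.
Variable R : realType.
Notation C := R[i].
Implicit Types (f g h : C -> C) (a b z w : C) (s : seq C).

(** If f has no order of vanishing at a, the multiplicity takes its default value 0
    and f itself is the cofactor, so the factorization always exists. *)
Lemma multiplicity_factor f a : holomorphic_disc f ->
  exists2 h, holomorphic_disc h & forall z, unit_disc z -> f z = (z - a) ^+ multiplicity f a * h z.
Proof.
move=> hf; rewrite /multiplicity; case: xgetP => [m _ [h [hh _ fh]]|_]; first by exists h.
by exists f => // z _; rewrite expr0 mul1r.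
Qed.

(** At a further point b the new quotient g(z) / (z - b)^k coincides near b with
    h(z) / P(z), where h is the cofactor of f at b and P the product already
    extracted, with P(b) != 0; so it extends holomorphically over b. *)
Lemma divide_zeros f s : holomorphic_disc f -> uniq s -> (forall a, a \in s -> unit_disc a) ->
  exists2 g, holomorphic_disc g &
    forall z, unit_disc z -> f z = (\prod_(a <- s) (z - a) ^+ multiplicity f a) * g z.
Proof.
move=> hf; elim: s => [|b s IH] /=.
  by exists f => // z _; rewrite big_nil mul1r.
move=> /andP[bs us] hs; have [g hg fg] : exists2 g, holomorphic_disc g &
    forall z, unit_disc z -> f z = (\prod_(a <- s) (z - a) ^+ multiplicity f a) * g z.
  by apply: IH => // a sa; apply: hs; rewrite inE sa orbT.
have bD : unit_disc b by apply: hs; rewrite inE eqxx.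
have [h hh fh] := multiplicity_factor f b hf.
set k := multiplicity f b in fh *.
pose P z := \prod_(a <- s) (z - a) ^+ multiplicity f a.
have holB a z : hol R (fun w => w - a) z.
  by apply: holD; [apply: hol_id | apply: hol_cst].
have holP' z : hol R P z.
  by apply: (hol_prod R C s (fun a w => (w - a) ^+ multiplicity f a)) => a; apply: holX.
have Pb : P b != 0.
  rewrite /P prodf_seq_neq0; apply/allP => a sa /=.
  by rewrite expf_neq0 // subr_eq0; apply: contraNneq bs => ->.
pose G z := if z == b then h b / P b else g z / (z - b) ^+ k.
have eqG z : unit_disc z -> z != b -> P z != 0 -> g z / (z - b) ^+ k = h z / P z.
  move=> zD zb Pz; have zbk : (z - b) ^+ k != 0 by rewrite expf_neq0 // subr_eq0.
  apply/eqP; rewrite eqr_div // mulrC -[_ * g z]/(P z * g z) /P -fg // fh // mulrC.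
  by [].
exists G.
  move=> z zD; have [zb|zb] := eqVneq z b.
    rewrite {}zb {z zD}.
    have /hol_cont/cvg_cmodP/(_ (cmod (P b))) := holP' b.
    rewrite cmod_gt0 => /(_ Pb) [r r0 hr].
    apply: (hol_near R (fun w => h w / P w) G _ (Num.min r (1 - cmod b))).
    - by rewrite lt_min r0 subr_gt0.
    - move=> w; rewrite lt_min => /andP[/hr w1 w2]; rewrite /G; case: eqVneq => [-> //|wb].
      have wD : unit_disc w.
        by rewrite /unit_disc /= -(subrK b w) (le_lt_trans (cmodD _ _ _)) // -ltrBrDr.
      rewrite eqG //; apply: contraTneq w1 => ->; by rewrite sub0r cmodN ltxx.
    - by apply: holM; [apply: hh | apply: holV].
  apply: (hol_near R (fun w => g w / (w - b) ^+ k) G _ (cmod (z - b))).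
  - by rewrite cmod_gt0 subr_eq0.
  - move=> w; rewrite /G; case: eqVneq => // ->; by rewrite cmod_distC ltxx.
  - apply: holM; first exact: hg.
    apply: (holV R (fun w => (w - b) ^+ k)); last exact: holX.
    by rewrite expf_neq0 // subr_eq0.
move=> z zD; rewrite big_cons -/k -/(P z) /G; case: eqVneq => [-> |zb].
  rewrite fh // -mulrA; congr (_ * _); by rewrite mulrC divfK.
rewrite fg // -/(P z) [_ ^+ k * P z]mulrC -mulrA; congr (_ * _).
by rewrite mulrC divfK // expf_neq0 // subr_eq0.
Qed.

(** The numerator in 1 - |b_a(z)|^2 = gap a * gap z / |1 - conj(a) z|^2, where
    b_a(z) = (z - a) / (1 - conj(a) z). *)
Definition gap z : R := 1 - cmod z ^+ 2.

Lemma gap_gt0 z : unit_disc z -> 0 < gap z.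
Proof. by rewrite /unit_disc /gap /= => h; rewrite subr_gt0 expr_lt1 ?cmod_ge0. Qed.

Lemma cmod_sqr_conj a z : cmod (1 - a^* * z) ^+ 2 = cmod (z - a) ^+ 2 + gap a * gap z.
Proof.
rewrite /gap !cmod_sqr; case: a => a1 a2; case: z => z1 z2 /=; ring.
Qed.

(** Turns the formula for 1 - |b_a|^2 into the lower bound |b_a| >= exp (- k). *)
Lemma expR_half_bound (k : R) : 0 <= k <= 1 / 2 -> expR (- (2 * k)) <= 1 - k.
Proof.
move=> /andP[k0 k1]; have h := expR_ge1Dx (2 * k).
have k2 : 0 < 1 - k by lra.
rewrite expRN -[leRHS]invrK lef_pV2 ?posrE ?expR_gt0 ?invr_gt0 //.
by apply: le_trans h; rewrite -[leLHS]mul1r ler_pdivrMr; nra.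
Qed.

(** Zero counting by the maximum principle. The function
    f * prod_a b_a^(- m_a) * exp (- sum_a m_a gap(a) h_a - E)
    is holomorphic on the disc (the zeros of the b_a divide out of f) and has
    modulus at most 1 on the boundary of the region, because
    |b_a| >= exp (- gap(a) Re h_a) there. At 0 this reads
    sum_a m_a (log (1/|a|) - gap(a) Re h_a(0)) <= Re E(0), while
    log (1/|a|) >= gap(a) / 2. *)
Lemma sum_multiplicity_le f (s : seq C) (W : C^o -> R) r y (E : C -> C) (h : C -> C -> C) :
  holomorphic_disc f -> cmod (f 0) = 1 -> uniq s -> (forall a, a \in s -> unit_disc a) ->
  0 <= r < 1 -> continuous W -> y <= W 0 ->
  holomorphic_disc E -> (forall a, a \in s -> holomorphic_disc (h a)) ->
  (forall z, cmod z <= r -> y <= W z -> cmod z = r \/ W z = y ->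
     cmod (f z) <= expR (Re (E z)) /\
     forall a, a \in s -> gap z / cmod (1 - a^* * z) ^+ 2 <= Re (h a z) /\
       gap a * (gap z / cmod (1 - a^* * z) ^+ 2) <= 1 / 2) ->
  (forall a, a \in s -> Re (h a 0) <= 1 / 4) ->
  \sum_(a <- s) (multiplicity f a)%:R * gap a <= 4 * Re (E 0).
Proof.
move=> hf f0 us sD /andP[r0 r1] cW W0 hE hh bd h0.
have [g hg fg] := divide_zeros f s hf us sD.
pose m a := multiplicity f a.
have holsum (F : C -> C -> C) z : (forall a, a \in s -> hol R (F a) z) ->
    hol R (fun w => \sum_(a <- s) F a w) z.
  move=> H; have -> : (fun w => \sum_(a <- s) F a w) =
      fun w => \sum_(a <- s) (if a \in s then F a w else 0).
    by apply: funext => w; apply: eq_big_seq => a ->.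
  apply: (hol_sum R C s (fun a w => if a \in s then F a w else 0)) => a.
  by case: (boolP (a \in s)) => sa; [apply: H | apply: hol_cst].
pose S z := \sum_(a <- s) ((m a)%:R * gap a)%:C * h a z.
pose F z := g z * (\prod_(a <- s) (1 - a^* * z) ^+ m a) * cexp R (- S z - E z).
have hF z : cmod z < 1 -> hol R F z.
  move=> zD; apply: holM.
    apply: (holM R g); first exact: hg.
    apply: (hol_prod R C s (fun a w => (1 - a^* * w) ^+ m a)) => a; apply: (holX R (fun w => 1 - a^* * w)).
    apply: holD; first exact: hol_cst.
    by apply: (holN R (fun w => a^* * w)); apply: holM; [apply: hol_cst | apply: hol_id].
  apply: (hol_comp R (fun z => - S z - E z) (cexp R)); last exact: hol_cexp.
  apply: holD; last by apply: (holN R E); exact: hE.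
  apply: (holN R S); apply: (holsum (fun a w => ((m a)%:R * gap a)%:C * h a w)) => a sa.
  by apply: holM; [apply: hol_cst | apply: hh].
have ReS z : Re (S z) = \sum_(a <- s) (m a)%:R * gap a * Re (h a z).
  by rewrite /S Re_sum; apply: eq_bigr => a _; rewrite Re_realM.
have cF z : cmod (F z) = cmod (g z) * (\prod_(a <- s) cmod (1 - a^* * z) ^+ m a) *
    (\prod_(a <- s) expR (- ((m a)%:R * gap a * Re (h a z)))) * expR (- Re (E z)).
  rewrite /F !cmodM cmod_cexp ReD !ReN expRD ReS -sumrN expR_sum cmod_prod !mulrA.
  by congr (_ * _ * _ * _); apply: eq_bigr => a _; rewrite cmodX.
have F0 : cmod (F 0) <= 1.
  apply: (maximum_principle R F W r y r1 hF cW) => //; last by rewrite cmod0.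
  move=> z zr yz hz; have [hfz hsz] := bd z zr yz hz.
  have zD : unit_disc z by apply: le_lt_trans zr r1.
  rewrite cF expRN ler_pdivrMr ?expR_gt0 // mul1r; apply: le_trans hfz.
  rewrite fg // cmodM cmod_prod -mulrA mulrC ler_wpM2r ?cmod_ge0 // -big_split /=.
  rewrite big_seq [leRHS]big_seq; apply: ler_prod => a sa.
  rewrite cmodX -/(m a) mulr_ge0 ?exprn_ge0 ?cmod_ge0 ?expR_ge0 //=.
  have [h1 h2] := hsz a sa.
  have -> : expR (- ((m a)%:R * gap a * Re (h a z))) = expR (- (gap a * Re (h a z))) ^+ m a.
    by rewrite -expRM_natl mulrN mulrA.
  rewrite -exprMn lerXn2r ?nnegrE ?mulr_ge0 ?cmod_ge0 ?expR_ge0 //.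
  set k := gap z / _ in h1 h2.
  have d0 : 0 < cmod (1 - a^* * z) ^+ 2.
    by rewrite cmod_sqr_conj ltr_wpDl ?sqr_ge0 // mulr_gt0 // gap_gt0 //; exact: sD.
  have ga := gap_gt0 a (sD a sa).
  have gk : 0 <= gap a * k by rewrite mulr_ge0 ?(ltW ga) // divr_ge0 ?(ltW d0) // ltW // gap_gt0.
  have := expR_half_bound (gap a * k); rewrite gk h2 => /(_ isT) h3.
  apply: (@le_trans _ _ (cmod (1 - a^* * z) * expR (- (gap a * k)))).
    by rewrite ler_wpM2l ?cmod_ge0 // ler_expR lerN2 ler_pM2l.
  rewrite -(@ler_pXn2r _ 2) ?nnegrE ?mulr_ge0 ?cmod_ge0 ?expR_ge0 //.
  rewrite exprMn -expRM_natl mulrN.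
  apply: (le_trans (ler_wpM2l (ltW d0) h3)).
  have -> : cmod (z - a) ^+ 2 = cmod (1 - a^* * z) ^+ 2 - gap a * gap z.
    by rewrite cmod_sqr_conj addrK.
  by rewrite mulrBr mulr1 lerD2l lerN2 /k [leRHS]mulrC -mulrA divfK ?gt_eqF.
have D0 : unit_disc (0 : C) by rewrite /unit_disc /mkset cmod0 ltr01.
move: f0; rewrite (fg _ D0).
rewrite cmodM cmod_prod => f0.
have P0 : \prod_(a <- s) cmod ((0 - a) ^+ m a) <= expR (- (\sum_(a <- s) (m a)%:R * gap a) / 2).
  rewrite mulNr mulr_suml -sumrN expR_sum big_seq [leRHS]big_seq; apply: ler_prod => a sa.
  rewrite cmod_ge0 /= cmodX sub0r cmodN -mulrA -mulrN expRM_natl.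
  rewrite lerXn2r ?nnegrE ?cmod_ge0 ?expR_ge0 //.
  rewrite -(@ler_pXn2r _ 2) ?nnegrE ?cmod_ge0 ?expR_ge0 // -expRM_natl mulrN mulrC divfK //.
  by have := expR_ge1Dx (- gap a); rewrite /gap opprB addrC subrK.
have g0 : expR ((\sum_(a <- s) (m a)%:R * gap a) / 2) <= cmod (g 0).
  have := ler_wpM2r (cmod_ge0 R (g 0)) P0; rewrite f0 mulNr expRN.
  by rewrite ler_pdivlMl ?expR_gt0 // mulr1.
move: F0; rewrite cF big1_seq; last by move=> a _; rewrite mulr0 subr0 cmod1 expr1n.
rewrite mulr1 -expR_sum -mulrA -expRD => F0.
have := le_trans (ler_wpM2r (expR_ge0 _) g0) F0.
rewrite -expRD -[leRHS]expR0 ler_expR => H.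
have : \sum_(a <- s) (m a)%:R * gap a * Re (h a 0) <= (\sum_(a <- s) (m a)%:R * gap a) / 4.
  rewrite mulr_suml big_seq [leRHS]big_seq; apply: ler_sum => a sa.
  rewrite ler_wpM2l ?mulr_ge0 // ?(ltW (gap_gt0 _ (sD a sa))) //.
  by have := h0 a sa; rewrite mul1r.
rewrite sumrN in H; move: H.
set T := \sum_(a <- s) _ * Re _; set U := \sum_(a <- s) _. clear; lra.
Qed.

End Zeros.

(** * Herglotz kernels *)

Section HalfPowers.
Variable R : realType.
Implicit Types delta : R.

Lemma geometric_sum_le (x : R) N : 0 <= x < 1 -> \sum_(k < N) x ^+ k <= (1 - x)^-1.
Proof.
move=> /andP[x0 x1]; rewrite -[leRHS]mul1r ler_pdivlMr ?subr_gt0 // mulrC -opprB mulNr -subrX1 opprB.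
by rewrite gerBl exprn_ge0.
Qed.

Lemma half_powR_lt1 delta : 0 < delta -> 0 <= (2^-1 : R) `^ delta < 1.
Proof.
move=> d0; rewrite powR_ge0 /=; have p1 : (1 : R) `^ delta = 1 by rewrite powR1.
rewrite -[ltRHS]p1; apply: gt0_ltr_powR => //; rewrite ?nnegrE ?invr_ge0 // invf_lt1 // ltr1n //.
Qed.

End HalfPowers.

Section Kernels.
Variable R : realType.
Notation C := R[i].
Implicit Types (a b z w eta : C) (r s x y : R).

Lemma cmod_one_sub b z : cmod b <= 1 -> cmod z < 1 -> 0 < cmod (1 - b^* * z).
Proof.
move=> b1 z1; have := cmod_dist_le R 1 (b^* * z).
rewrite cmodM cmod_conj cmod1 => h.
have h2 : cmod b * cmod z < 1.
  by apply: le_lt_trans z1; rewrite ler_piMl ?cmod_ge0.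
by apply: lt_le_trans h; rewrite normr_gt0 subr_eq0 gt_eqF.
Qed.

Lemma cmod_circle eta z : unit_circle eta -> cmod (1 - eta^* * z) = cmod (z - eta).
Proof.
move=> e1; apply/eqP; rewrite -(@eqrXn2 _ 2) ?cmod_ge0 // cmod_sqr_conj.
by rewrite {1}/gap (e1 : cmod eta = 1) expr1n subrr mul0r addr0.
Qed.

Lemma circle_dist_gt0 eta z : unit_circle eta -> unit_disc z -> 0 < cmod (z - eta).
Proof.
move=> e1 z1; rewrite cmod_gt0 subr_eq0; apply: contraTneq z1 => ->.
by rewrite /unit_disc /= (e1 : cmod eta = 1) ltxx.
Qed.

Lemma circle_dist_ge eta z : unit_circle eta -> 1 - cmod z <= cmod (z - eta).
Proof.
move=> e1; rewrite -(e1 : cmod eta = 1) cmod_distC.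
exact: le_trans (ler_norm _) (cmod_dist_le _ _ _).
Qed.

Lemma circle_dist_le2 eta z : unit_circle eta -> unit_disc z -> cmod (z - eta) <= 2.
Proof.
move=> e1 z1; rewrite (le_trans (cmodB _ _ _)) // (e1 : cmod eta = 1).
by rewrite -[leRHS]/(1 + 1) lerD2r ltW.
Qed.

Lemma gap_le1 z : gap R z <= 1.
Proof. by rewrite /gap gerBl sqr_ge0. Qed.

Lemma gap_le_2dist z : unit_disc z -> gap R z <= 2 * (1 - cmod z).
Proof.
rewrite /unit_disc /gap /= => z1; have := cmod_ge0 R z; move: z1.
by move: (cmod z) => x; clear; nra.
Qed.

Lemma dist_le_gap z : unit_disc z -> 1 - cmod z <= gap R z.
Proof.
rewrite /unit_disc /gap /= => z1; have := cmod_ge0 R z; move: z1.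
by move: (cmod z) => x; clear; nra.
Qed.

Lemma gap_le_circle eta z : unit_circle eta -> unit_disc z -> gap R z <= 2 * cmod (z - eta).
Proof.
move=> e1 z1; apply: le_trans (gap_le_2dist z z1) _.
by rewrite ler_pM2l // circle_dist_ge.
Qed.

(** 1 - conj(a) eta has modulus |a - eta| and differs from 1 - conj(a) z by at most
    |z - eta|. *)
Lemma half_dist_le eta a z K : unit_circle eta -> cmod a <= 1 -> 2 <= K ->
  K * cmod (z - eta) <= cmod (a - eta) -> cmod (a - eta) / 2 <= cmod (1 - a^* * z).
Proof.
move=> e1 a1 K2 h.
have E : 1 - a^* * eta = (1 - a^* * z) + a^* * (z - eta) by ring.
have : cmod (1 - a^* * eta) <= cmod (1 - a^* * z) + cmod (z - eta).
  rewrite E (le_trans (cmodD _ _ _)) // lerD2l cmodM cmod_conj ler_piMl ?cmod_ge0 //.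
have -> : cmod (1 - a^* * eta) = cmod (a - eta).
  rewrite -(cmod_circle eta a e1) -cmod_conj; congr (cmod _).
  by case: (a) => x1 x2; case: (eta) => y1 y2; apply/eqP; rewrite eq_complex /=; apply/andP; split; apply/eqP; ring.
have : 2 * cmod (z - eta) <= K * cmod (z - eta) by rewrite ler_wpM2r ?cmod_ge0.
by move: h; clear; lra.
Qed.

(** The Herglotz kernel of b: its real part is positive harmonic, with value 1 at 0;
    for |b| = 1 it is the Poisson kernel of b. *)
Definition kern b z : C := (1 + b^* * z) / (1 - b^* * z).

Lemma hol_kern b z : cmod b <= 1 -> unit_disc z -> hol R (kern b) z.
Proof.
move=> b1 z1.
have h : hol R (fun w => b^* * w) z by apply: holM; [apply: hol_cst | apply: hol_id].
apply: (holM R (fun w => 1 + b^* * w) (fun w => (1 - b^* * w)^-1)).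
  by apply: (holD R (fun=> 1)); first exact: hol_cst.
apply: (holV R (fun w => 1 - b^* * w)); first by rewrite -cmod_gt0 cmod_one_sub.
apply: (holD R (fun=> 1) (fun w => - (b^* * w))); first exact: hol_cst.
exact: (holN R (fun w => b^* * w)).
Qed.

Lemma kern_at0 b : kern b 0 = 1.
Proof. by rewrite /kern mulr0 addr0 subr0 divr1. Qed.

Lemma Re_kern b z : Re (kern b z) = (1 - cmod b ^+ 2 * cmod z ^+ 2) / cmod (1 - b^* * z) ^+ 2.
Proof.
have -> : cmod b ^+ 2 * cmod z ^+ 2 = cmod (b^* * z) ^+ 2 by rewrite cmodM cmod_conj exprMn.
rewrite /kern; move: (b^* * z) => w; rewrite !cmod_sqr; case: w => x y /=.
by ring.
Qed.

Lemma kern_ge_gap b z : cmod b <= 1 -> cmod z <= 1 ->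
  gap R z / cmod (1 - b^* * z) ^+ 2 <= Re (kern b z) /\
  gap R b / cmod (1 - b^* * z) ^+ 2 <= Re (kern b z).
Proof.
move=> b1 z1; rewrite Re_kern; split; rewrite ler_wpM2r ?invr_ge0 ?sqr_ge0 // /gap lerD2l lerN2.
  by rewrite ler_piMl ?sqr_ge0 // exprn_ile1 // cmod_ge0.
by rewrite ler_piMr ?sqr_ge0 // exprn_ile1 // cmod_ge0.
Qed.

Lemma Re_kern_ge0 b z : cmod b <= 1 -> cmod z <= 1 -> 0 <= Re (kern b z).
Proof.
move=> b1 z1; apply: le_trans (proj1 (kern_ge_gap b z b1 z1)).
by rewrite divr_ge0 ?sqr_ge0 // /gap subr_ge0 exprn_ile1 // cmod_ge0.
Qed.

(** A dyadic superposition of the kernels of the points (1 - 2^-k) eta. The weight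
    (2^-k)^delta makes it dominate |z - eta|^-(1 - delta), up to a constant factor,
    down to the scale 2^-N, while the total mass stays bounded in N. *)
Definition dkern (N : nat) (delta : R) eta z : C :=
  \sum_(k < N.+1) ((2^-1 `^ delta) ^+ k)%:C * kern ((1 - 2^-1 ^+ k)%:C * eta) z.

Lemma half_pow_le1 k : 0 < (2^-1 : R) ^+ k <= 1.
Proof.
rewrite exprn_gt0 ?invr_gt0 //= exprn_ile1 ?invr_ge0 // invf_le1 // ler1n //.
Qed.

Lemma cmod_dkern_node k eta : unit_circle eta -> cmod ((1 - 2^-1 ^+ k)%:C * eta) = 1 - 2^-1 ^+ k.
Proof.
move=> e1; rewrite cmodM (e1 : cmod eta = 1) mulr1 cmod_real ger0_norm // subr_ge0.
by case/andP: (half_pow_le1 k).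
Qed.

Lemma dkern_node_le1 k eta : unit_circle eta -> cmod ((1 - 2^-1 ^+ k)%:C * eta) <= 1.
Proof. by move=> e1; rewrite cmod_dkern_node // gerBl; case/andP: (half_pow_le1 k) => /ltW. Qed.

Lemma hol_dkern N delta eta z : unit_circle eta -> unit_disc z -> hol R (dkern N delta eta) z.
Proof.
move=> e1 z1; apply: (hol_sum R 'I_N.+1 _ (fun k w => ((2^-1 `^ delta) ^+ k)%:C * kern ((1 - 2^-1 ^+ k)%:C * eta) w)) => k.
by apply: holM; [apply: hol_cst | apply: hol_kern => //; apply: dkern_node_le1].
Qed.

Lemma dkern0_le N delta eta : 0 < delta -> Re (dkern N delta eta 0) <= (1 - 2^-1 `^ delta)^-1.
Proof.
move=> d0; rewrite /dkern Re_sum.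
under eq_bigr do rewrite kern_at0 mulr1 /=.
exact/geometric_sum_le/half_powR_lt1.
Qed.

Lemma Re_dkern_ge0 N delta eta z : unit_circle eta -> unit_disc z -> 0 <= Re (dkern N delta eta z).
Proof.
move=> e1 z1; rewrite /dkern Re_sum; apply: sumr_ge0 => k _.
rewrite Re_realM mulr_ge0 ?exprn_ge0 ?powR_ge0 // Re_kern_ge0 ?(ltW z1) //.
exact: dkern_node_le1.
Qed.

Lemma dyadic_scale N s : 2^-1 ^+ N <= s -> s <= 2 ->
  exists2 k, (k < N.+1)%N & 2^-1 ^+ k <= s <= 2 * 2^-1 ^+ k.
Proof.
move=> h1 h2; elim: N h1 => [|N IH] h1; first by exists 0%N; rewrite // h1 expr0 mulr1.
have [/IH [k kN hk]|hs] := lerP (2^-1 ^+ N) s; first by exists k => //; apply: ltnW.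
by exists N.+1; rewrite // h1 /= exprS mulrA divff // mul1r ltW.
Qed.

(** The term k with 2^-k <= |z - eta| <= 2 * 2^-k alone suffices: its node
    b = (1 - 2^-k) eta satisfies gap b >= 2^-k and |1 - conj(b) z| <= 3 * 2^-k, so
    its kernel is at least 1 / (9 * 2^-k). *)
Lemma dkern_ge N delta eta z : unit_circle eta -> unit_disc z -> delta < 1 ->
  2^-1 ^+ N <= cmod (z - eta) ->
  cmod (z - eta) `^ (- (1 - delta)) <= 9 * Re (dkern N delta eta z).
Proof.
move=> e1 z1 d1 hs; set s := cmod (z - eta).
have [k kN /andP[k1 k2]] := dyadic_scale N s hs (circle_dist_le2 eta z e1 z1).
have [t0 t1] := andP (half_pow_le1 k).
set t := 2^-1 ^+ k in k1 k2 t0 t1.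
have s0 : 0 < s by apply: lt_le_trans k1.
pose term (i : nat) := ((2^-1 `^ delta) ^+ i)%:C * kern ((1 - 2^-1 ^+ i)%:C * eta) z.
have term0 i : 0 <= Re (term i).
  rewrite /term Re_realM mulr_ge0 ?exprn_ge0 ?powR_ge0 // Re_kern_ge0 ?(ltW z1) //.
  exact: dkern_node_le1.
have : Re (term k) <= Re (dkern N delta eta z).
  rewrite /dkern Re_sum (bigD1 (Ordinal kN)) //= lerDl; apply: sumr_ge0 => i _.
  exact: term0.
rewrite -(@ler_pM2l _ 9) //; apply: le_trans.
rewrite /term Re_realM -/t.
have -> : (2^-1 `^ delta) ^+ k = t `^ delta.
  rewrite -powR_mulrn ?powR_ge0 // -powRrM mulrC powRrM powR_mulrn ?invr_ge0 //.
set b := (1 - t)%:C * eta.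
have cb : cmod b = 1 - t by apply: cmod_dkern_node.
have gb : t <= gap R b.
  by rewrite /gap cb; move: t0 t1; clear; nra.
have b1 : cmod b <= 1 by rewrite cb gerBl ltW.
have d3 : cmod (1 - b^* * z) <= 3 * t.
  have -> : 1 - b^* * z = (1 - eta^* * z) + t%:C * (eta^* * z).
    rewrite /b; case: (eta) => y1 y2; case: (z) => x1 x2.
    by apply/eqP; rewrite eq_complex /=; apply/andP; split; apply/eqP; ring.
  rewrite (le_trans (cmodD _ _ _)) // cmod_circle // -/s cmodM cmod_real gtr0_norm //.
  have : cmod (eta^* * z) <= 1 by rewrite cmodM cmod_conj (e1 : cmod eta = 1) mul1r ltW.
  rewrite -(ler_pM2l t0) mulr1; move: k2; clear; lra.
have d0 : 0 < cmod (1 - b^* * z) by apply: cmod_one_sub.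
have hk : (9 * t)^-1 <= Re (kern b z).
  apply: le_trans (proj2 (kern_ge_gap b z b1 (ltW z1))).
  apply: (@le_trans _ _ (t / (3 * t) ^+ 2)).
    by rewrite le_eqVlt; apply/orP; left; apply/eqP; field; rewrite gt_eqF.
  rewrite ler_pM ?invr_ge0 ?sqr_ge0 ?(ltW t0) // lef_pV2 ?posrE ?exprn_gt0 // ?mulr_gt0 //.
  by rewrite lerXn2r // nnegrE ?(ltW d0) // mulr_ge0 // ltW.
apply: (@le_trans _ _ (9 * (t `^ delta / (9 * t)))); last first.
  by rewrite ler_pM2l // ler_pM2l // powR_gt0.
have -> : 9 * (t `^ delta / (9 * t)) = t `^ delta / t by field; rewrite gt_eqF.
have -> : t `^ delta / t = t `^ (- (1 - delta)).
  have c : (delta == 1) ==> (t != 0) by rewrite (gt_eqF t0) implybT.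
  by rewrite opprB (powRB c) powRr1 // ltW.
rewrite !powRN lef_pV2 ?posrE ?powR_gt0 //.
by apply: ge0_ler_powR => //; rewrite ?subr_ge0 ?nnegrE ltW.
Qed.

End Kernels.

(** * Weights with power singularities on the circle *)

Section Weights.
Variables (R : realType) (n : nat) (eta : 'I_n -> R[i]).
Hypothesis n_ge1 : (1 <= n)%N.
Hypothesis eta_inj : injective eta.
Hypothesis eta_circle : forall j, unit_circle (eta j).
Notation C := R[i].
Implicit Types (a z : C) (e q beta t : 'I_n -> R) (p delta y w x : R).

Let dist z j := cmod (z - eta j).

Lemma le0_ger_powR r x y : r <= 0 -> 0 < x -> x <= y -> y `^ r <= x `^ r.
Proof.
move=> r0 x0 xy; have y0 : 0 < y by apply: lt_le_trans xy.
have E u : 0 < u -> u `^ r = (u `^ (- r))^-1 by move=> u0; rewrite powRN invrK.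
rewrite !E // lef_pV2 ?posrE ?powR_gt0 //.
by apply: ge0_ler_powR; rewrite ?nnegrE ?oppr_ge0 ?(ltW x0) ?(ltW y0).
Qed.

Lemma powR_le_abs w x r : 1 <= w -> 0 < x -> x <= w -> (r < 0 -> w^-1 <= x) ->
  x `^ r <= w `^ `|r|.
Proof.
move=> w1 x0 xw h; have w0 : 0 < w by apply: lt_le_trans w1.
have [r0|r0] := lerP 0 r; first by rewrite ger0_norm //; apply: ge0_ler_powR; rewrite ?nnegrE ?(ltW x0) ?(ltW w0).
rewrite ltr0_norm //.
have -> : x `^ r = x^-1 `^ (- r) by rewrite -powR_inv1 ?(ltW x0) // -powRrM mulN1r opprK.
apply: ge0_ler_powR; rewrite ?nnegrE ?invr_ge0 ?(ltW x0) ?(ltW w0) ?oppr_ge0 ?(ltW r0) //.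
by rewrite -[leRHS]invrK lef_pV2 ?posrE ?invr_gt0 // h.
Qed.

Lemma powR_sum w (I : finType) (F : I -> R) : 0 < w ->
  \prod_i w `^ F i = w `^ (\sum_i F i).
Proof.
move=> w0; elim/big_rec2: _ => [|i u v _ ->]; first by rewrite powRr0.
by rewrite powRD // (gt_eqF w0) implybT.
Qed.

(** The upper bound on t_i matters for positive exponents and the lower bound for
    negative ones only; this asymmetry is used in [far_case]. *)
Lemma prod_powR_le e t w j : 1 <= w -> (forall i, 0 < t i) ->
  (forall i, i != j -> t i <= w /\ (e i < 0 -> w^-1 <= t i)) ->
  \prod_i t i `^ e i <= w `^ (\sum_i `|e i|) * t j `^ e j.
Proof.
move=> w1 t0 h; have w0 : 0 < w by apply: lt_le_trans w1.
rewrite (bigD1 j) //= mulrC ler_wpM2r ?powR_ge0 // -powR_sum // [leRHS](bigD1 j) //=.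
rewrite -[leLHS]mul1r ler_pM ?ler01 //; first by apply: prodr_ge0 => i _; apply: powR_ge0.
  by rewrite -[leLHS](powRr0 w) ler_powR.
apply: ler_prod => i /h [h1 h2]; rewrite powR_ge0 /=; exact: powR_le_abs.
Qed.

Lemma separation : exists2 sigma, 0 < sigma <= 1 &
  forall i j, i != j -> 2 * sigma <= cmod (eta i - eta j).
Proof.
pose s := \big[Order.min/1]_(ij : 'I_n * 'I_n | ij.1 != ij.2) (cmod (eta ij.1 - eta ij.2) / 2).
exists s.
  rewrite bigmin_le_id andbT; apply: lt_bigmin => // -[i j] /= ij.
  by rewrite divr_gt0 // cmod_gt0 subr_eq0 (inj_eq eta_inj).
move=> i j ij; rewrite mulrC -ler_pdivlMr //.
exact: (@bigmin_le_cond _ _ _ _ (i, j) (fun ij => ij.1 != ij.2) (fun ij => cmod (eta ij.1 - eta ij.2) / 2) ij).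
Qed.

(** As the eta_j are separated, a point is close to at most one of them. *)
Lemma nearest sigma z : 0 < sigma ->
  (forall i j, i != j -> 2 * sigma <= cmod (eta i - eta j)) ->
  exists j, forall i, i != j -> sigma <= dist z i.
Proof.
move=> s0 sep; have [[j hj]|/forallNP h] := pselect (exists j, dist z j < sigma).
  exists j => i ij; have := sep i j ij.
  have : cmod (eta i - eta j) <= dist z i + dist z j.
    by rewrite /dist [cmod (z - eta i)]cmod_distC -{1}(subrK z (eta i)) -addrA cmodD.
  by move: hj; clear; lra.
exists (Ordinal n_ge1) => i _; rewrite leNgt; exact/negP.
Qed.

Lemma dist_gt0 z j : unit_disc z -> 0 < dist z j.
Proof. exact: circle_dist_gt0. Qed.

Lemma dist_le2 z j : unit_disc z -> dist z j <= 2.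
Proof. exact: circle_dist_le2. Qed.

Lemma prod_dist_gt0 e z : unit_disc z -> 0 < prod_dist eta e z.
Proof. by move=> zD; apply: prodr_gt0 => j _; rewrite powR_gt0 // dist_gt0. Qed.

(** The function V of the introduction: zeros are counted on its superlevel sets. *)
Definition weight p beta z := gap R z `^ p * prod_dist eta beta z.

Lemma weight_gt0 p beta z : unit_disc z -> 0 < weight p beta z.
Proof. by move=> zD; rewrite mulr_gt0 ?prod_dist_gt0 // powR_gt0 // gap_gt0. Qed.

Lemma prod_dist_local e z sigma : unit_disc z -> 0 < sigma <= 1 ->
  (forall i j, i != j -> 2 * sigma <= cmod (eta i - eta j)) ->
  exists j, prod_dist eta e z <= (2 / sigma) `^ (\sum_i `|e i|) * dist z j `^ e j.
Proof.
move=> zD /andP[s0 s1] sep; have [j hj] := nearest sigma z s0 sep.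
exists j; apply: (prod_powR_le e (dist z)) => //.
- by rewrite ler_pdivlMr // mul1r (le_trans s1) // ler1n.
- by move=> i; apply: dist_gt0.
move=> i ij; split.
  by rewrite (le_trans (dist_le2 z i zD)) // ler_pdivlMr // ler_piMr.
move=> _; rewrite invf_div ler_pdivrMr // (le_trans (hj i ij)) // ler_peMr ?ler1n //.
exact: ltW (dist_gt0 _ _ _).
Qed.

(** Where a factor t_j^beta_j with beta_j < 0 is large, gap^p compensates for it,
    because gap <= 2 t_j and beta_j >= -p. *)
Lemma weight_bounded p beta : 0 <= p -> (forall j, - p <= beta j) ->
  exists B, 0 < B /\ forall z, unit_disc z -> weight p beta z <= B.
Proof.
move=> p0 hb; have [sigma s01 sep] := separation.
pose L := (2 / sigma) `^ (\sum_i `|beta i|).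
have L0 : 0 < L by apply: powR_gt0; apply: divr_gt0 => //; case/andP: s01.
pose M := 2 `^ (\sum_i `|beta i|) : R.
have M0 : 0 < M by apply: powR_gt0.
exists (L * M); split; first exact: mulr_gt0.
move=> z zD; have [j hj] := prod_dist_local beta z sigma zD s01 sep.
have d0 := dist_gt0 z j zD; have d2 := dist_le2 z j zD.
have g0 := gap_gt0 R z zD; have g1 := gap_le1 R z.
rewrite /weight; apply: le_trans (ler_wpM2l (powR_ge0 _ _) hj) _.
rewrite mulrCA ler_pM2l //.
have bj : 2 `^ `|beta j| <= M.
  by rewrite ler_powR ?ler1n // (bigD1 j) //= lerDl sumr_ge0.
apply: le_trans bj; have [b0|b0] := lerP 0 (beta j).
  rewrite ger0_norm // -[leRHS]mul1r ler_pM ?powR_ge0 //.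
    by rewrite -[leRHS](powRr0 (gap R z)) ger_powR // g0.
  by apply: ge0_ler_powR => //; rewrite nnegrE // ltW.
have gd : gap R z / 2 <= dist z j.
  by rewrite ler_pdivrMr // mulrC gap_le_circle.
apply: (@le_trans _ _ (gap R z `^ p * (gap R z / 2) `^ beta j)).
  by rewrite ler_pM2l ?powR_gt0 // le0_ger_powR ?divr_gt0 // ltW.
rewrite ltr0_norm // powRM ?invr_ge0 ?(ltW g0) // mulrA -powRD; last by rewrite (gt_eqF g0) implybT.
rewrite -[2^-1]powR_inv1 // -powRrM mulN1r -[leRHS]mul1r ler_pM ?powR_ge0 //.
rewrite -[leRHS](powRr0 (gap R z)) ger_powR ?g0 // -lerBlDl sub0r; exact: hb.
Qed.

(** On {V >= y} the growth exponent is 1/V <= 1/y times powers of the t_j with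
    exponents beta_j - q_j >= - (1 - delta), which have a harmonic majorant; up to
    constants only the point eta_j nearest to z contributes. The scale N depends on
    how close z is to the circle, but the constant does not. *)
Lemma inv_growth_le p q beta delta : 0 < delta < 1 ->
  (forall j, q j - 1 + delta <= beta j) ->
  exists2 c, 0 <= c & forall N y z, unit_disc z -> 2^-1 ^+ N <= 1 - cmod z -> 0 < y ->
    y <= weight p beta z ->
    (weight p q z)^-1 <= c / y * \sum_j Re (dkern R N delta (eta j) z).
Proof.
move=> /andP[d0 d1] hb; have [sigma s01 sep] := separation.
pose e j := beta j - q j.
pose L := (2 / sigma) `^ (\sum_i `|e i|).
have L0 : 0 < L by apply: powR_gt0; apply: divr_gt0 => //; case/andP: s01.
pose M := 2 `^ (\sum_i `|e i + (1 - delta)|) : R.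
have M0 : 0 < M by apply: powR_gt0.
exists (L * M * 9); first by rewrite !mulr_ge0 // ltW.
move=> N y z zD zN y0 yw.
have [j hj] := prod_dist_local e z sigma zD s01 sep.
have d0' := dist_gt0 z j zD; have d2 := dist_le2 z j zD.
have pq := prod_dist_gt0 q z zD; have gp := powR_gt0 p (gap_gt0 R z zD).
have E : prod_dist eta beta z = prod_dist eta q z * prod_dist eta e z.
  rewrite /prod_dist -big_split /=; apply: eq_bigr => i _.
  by rewrite -powRD ?(gt_eqF (dist_gt0 z i zD)) ?implybT // /e subrKC.
apply: (@le_trans _ _ (prod_dist eta e z / y)).
  rewrite ler_pdivlMr // mulrC ler_pdivrMr ?mulr_gt0 //.
  by rewrite mulrC /weight -mulrA -E.
rewrite -[leRHS]mulrA [leRHS]mulrC -!mulrA mulrC ler_pM2r ?invr_gt0 //.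
apply: (le_trans hj); rewrite -/L mulrC -!mulrA ler_pM2l //.
have hD : dist z j `^ (- (1 - delta)) <= 9 * Re (dkern R N delta (eta j) z).
  by apply: dkern_ge => //; rewrite (le_trans zN) // circle_dist_ge.
have -> : dist z j `^ e j = dist z j `^ (e j + (1 - delta)) * dist z j `^ (- (1 - delta)).
  by rewrite -powRD ?(gt_eqF d0') ?implybT // addrK.
have ej : 0 <= e j + (1 - delta) by have := hb j; rewrite /e; clear; lra.
apply: ler_pM; rewrite ?powR_ge0 //.
  apply: (@le_trans _ _ (2 `^ (e j + (1 - delta)))).
    by apply: ge0_ler_powR => //; rewrite nnegrE // ltW.
  by rewrite ler_powR ?ler1n // (bigD1 j) //= ger0_norm // lerDl sumr_ge0.
apply: (le_trans hD); rewrite ler_pM2l // (bigD1 j) //= lerDl.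
by apply: sumr_ge0 => i _; apply: Re_dkern_ge0.
Qed.

(** If none of the factors of V were K times better at a than at z, then V(a) would
    be at most K^(p + sum |beta_j|) V(z). *)
Lemma weight_trichotomy p beta K a z : 0 <= p -> 1 <= K -> unit_disc a -> unit_disc z ->
  K `^ (p + \sum_j `|beta j|) * weight p beta z < weight p beta a ->
  [\/ K * gap R z <= gap R a,
      exists2 j, 0 < beta j & K * dist z j <= dist a j |
      exists2 j, beta j < 0 & K * dist a j <= dist z j].
Proof.
move=> p0 K1 aD zD h; have K0 : 0 < K by apply: lt_le_trans K1.
have ga := gap_gt0 R a aD; have gz := gap_gt0 R z zD.
have [c1|c1] := lerP (K * gap R z) (gap R a); first by constructor 1.
have [c2|/forall2NP c2] := pselect (exists2 j, 0 < beta j & K * dist z j <= dist a j).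
  by constructor 2.
have [c3|/forall2NP c3] := pselect (exists2 j, beta j < 0 & K * dist a j <= dist z j).
  by constructor 3.
exfalso; move: h; apply/negP; rewrite -leNgt.
rewrite powRD ?(gt_eqF K0) ?implybT // /weight mulrACA -powR_sum // -powRM ?(ltW K0) ?(ltW gz) //.
apply: ler_pM; rewrite ?powR_ge0 ?(ltW (prod_dist_gt0 _ _ _)) //.
  by apply: ge0_ler_powR; rewrite ?nnegrE ?mulr_ge0 // ltW.
rewrite /prod_dist -big_split /=; apply: ler_prod => j _; rewrite powR_ge0 /=.
have a0 := dist_gt0 a j aD; have z0 := dist_gt0 z j zD; rewrite -!/(dist _ j).
have [b0|b0|->] := ltrgtP (beta j) 0; last by rewrite !powRr0 normr0 powRr0 mulr1.
  have [|/negP] := c3 j; first by rewrite b0.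
  rewrite -ltNge => /ltW c.
  have -> : K `^ `|beta j| * dist z j `^ beta j = (K^-1 * dist z j) `^ beta j.
    rewrite powRM ?invr_ge0 ?(ltW K0) ?(ltW z0) //; congr (_ * _).
    by rewrite ltr0_norm // -powR_inv1 ?(ltW K0) // -powRrM mulN1r.
  by rewrite le0_ger_powR ?mulr_gt0 ?invr_gt0 ?(ltW b0) // ler_pdivrMl.
have [|/negP] := c2 j; first by rewrite b0.
rewrite -ltNge => /ltW c.
rewrite gtr0_norm // -powRM ?(ltW K0) ?(ltW z0) //.
by apply: ge0_ler_powR; rewrite ?nnegrE ?mulr_ge0 // ltW.
Qed.

End Weights.

(** * Level sets of the weight *)

Section RealContinuity.
Variables (R : realType) (T : topologicalType).
Implicit Types g h : T -> R.

Lemma continuous_powR g r : continuous g -> (forall z, 0 < g z) ->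
  continuous (fun z => g z `^ r).
Proof.
move=> cg g0.
have -> : (fun z => g z `^ r) = (fun z => expR (r * ln (g z))).
  by apply: funext => w; rewrite /powR gt_eqF.
move=> z.
apply: (@continuous_comp _ _ _ (fun z => r * ln (g z)) expR); last exact: continuous_expR.
apply: (@continuous_comp _ _ _ (fun z => ln (g z)) (fun x => r * x)); last exact: mulrl_continuous.
by apply: (@continuous_comp _ _ _ g (@ln R)); [exact: cg | exact: continuous_ln].
Qed.

Lemma continuous_mul g h : continuous g -> continuous h -> continuous (fun z => g z * h z).
Proof. by move=> cg ch z; apply: cvgM; [exact: cg | exact: ch]. Qed.

Lemma continuous_cstB (c : R) g : continuous g -> continuous (fun z => c - g z).
Proof. by move=> cg z; apply: cvgB; [exact: cvg_cst | exact: cg]. Qed.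

Lemma continuous_bigprod I (s : seq I) (g : I -> T -> R) : (forall i, continuous (g i)) ->
  continuous (fun z => \prod_(i <- s) g i z).
Proof.
move=> h; elim: s => [|i s IH].
  have -> : (fun z => \prod_(i <- [::]) g i z) = fun=> 1 by apply: funext => w; rewrite big_nil.
  by move=> z; apply: cvg_cst.
have -> : (fun z => \prod_(i <- i :: s) g i z) = fun z => g i z * \prod_(i <- s) g i z.
  by apply: funext => w; rewrite big_cons.
exact: continuous_mul.
Qed.

Lemma continuous_max_cst g (c : R) : continuous g -> continuous (fun z => Num.max (g z) c).
Proof.
by move=> cg z; apply: (@continuous_max _ _ g (fun=> c) z); [exact: cg | exact: cvg_cst].
Qed.

End RealContinuity.

Section Counting.
Variables (R : realType) (n : nat) (eta : 'I_n -> R[i]).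
Hypothesis n_ge1 : (1 <= n)%N.
Hypothesis eta_inj : injective eta.
Hypothesis eta_circle : forall j, unit_circle (eta j).
Notation C := R[i].
Implicit Types (a z : C) (e q beta t : 'I_n -> R) (p delta y w x : R).

Let dist z j := cmod (z - eta j).
Let wt := weight R n eta.
Let dist_gt0' z j : unit_disc z -> 0 < dist z j.
Proof. exact: circle_dist_gt0. Qed.
Let dist_le2' z j : unit_disc z -> dist z j <= 2.
Proof. exact: circle_dist_le2. Qed.

(** The case of [weight_trichotomy] in which a negative exponent is responsible.
    As t_j(a) is small, all other t_i(a) are bounded below, and then so are the
    t_i(z) with beta_i > 0. Up to constants gap(z)^p <= y t_j(z)^(- beta_j), and
    L y <= gap(a)^(p (1 + delta)) t_j(a)^beta_j <= t_j(a)^(p (1 + delta) + beta_j)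
    (using gap <= 2 t_j). The last exponent is nonnegative and
    t_j(a) <= t_j(z), whence gap(z)^p <= (small) t_j(z)^(p (1 + delta)). *)
Lemma far_case p beta delta sigma K M : 0 <= p -> (forall j, - p <= beta j) -> 0 < delta ->
  0 < sigma <= 1 -> (forall i j, i != j -> 2 * sigma <= cmod (eta i - eta j)) ->
  1 <= K -> 2 / sigma <= K -> 0 < M ->
  exists2 L, 0 < L & forall a z y j, unit_disc a -> unit_disc z -> beta j < 0 ->
    K * dist a j <= dist z j -> (forall i, 0 < beta i -> dist a i < K * dist z i) ->
    wt p beta z = y -> L * y <= gap R a `^ (p * delta) * wt p beta a ->
    gap R z <= M * dist z j `^ (1 + delta).
Proof.
move=> p0 hb d0 /andP[s0 s1] sep K1 Ks M0.
have K0 : 0 < K by apply: lt_le_trans K1.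
pose w := 2 * K / sigma.
have w2 : 2 <= w.
  by rewrite /w ler_pdivlMr // ler_pM2l // (le_trans s1).
have w1 : 1 <= w by rewrite (le_trans _ w2) // ler1n.
have w0 : 0 < w by apply: lt_le_trans w1.
pose La := w `^ (\sum_i `|beta i|); have La0 : 0 < La by apply: powR_gt0.
pose T := 2 `^ (p * (1 + delta)) : R; have T0 : 0 < T by apply: powR_gt0.
exists (La * La * T * (M^-1) `^ p); first by rewrite !mulr_gt0 // powR_gt0 // invr_gt0.
move=> a z y j aD zD bj h1 h2 wy hL.
have p1 : 0 < p by have := hb j; move: bj; lra.
set u := dist a j in h1; set s := dist z j in h1 *.
have u0 : 0 < u by apply: dist_gt0'.
have us : u <= s by apply: le_trans h1; rewrite ler_peMl // ltW.
have s0' : 0 < s by apply: lt_le_trans us.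
have usig : u <= sigma.
  rewrite -(ler_pM2l K0); apply: (le_trans h1); apply: le_trans (dist_le2' z j zD) _.
  by rewrite -ler_pdivrMr.
have far i : i != j -> sigma <= dist a i.
  move=> ij; have := sep i j ij.
  have : cmod (eta i - eta j) <= dist a i + dist a j.
    by rewrite /dist [cmod (a - eta i)]cmod_distC -{1}(subrK a (eta i)) -addrA cmodD.
  by rewrite -/u; move: usig; lra.
have wi : w^-1 = sigma / (2 * K) by rewrite /w invf_div.
have ga := gap_gt0 R a aD; have gz := gap_gt0 R z zD.
have Pa : prod_dist eta beta a <= La * u `^ beta j.
  apply: (prod_powR_le R n beta (dist a)) => // [i|i ij]; first exact: dist_gt0'.
  split; first by rewrite (le_trans (dist_le2' a i aD)).
  move=> _; rewrite wi (le_trans _ (far i ij)) // ler_pdivrMr ?mulr_gt0 //.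
  by rewrite ler_peMr ?(ltW s0) // -[leLHS]mulr1 ler_pM // ler1n.
have Pz : (prod_dist eta beta z)^-1 <= La * s `^ (- beta j).
  have -> : (prod_dist eta beta z)^-1 = \prod_i dist z i `^ (- beta i).
    by rewrite /prod_dist -prodfV; apply: eq_bigr => i _; rewrite powRN.
  have -> : La = w `^ (\sum_i `|- beta i|) by congr (_ `^ _); apply: eq_bigr => i _; rewrite normrN.
  apply: (prod_powR_le R n (fun i => - beta i) (dist z)) => // [i|i ij]; first exact: dist_gt0'.
  split; first by rewrite (le_trans (dist_le2' z i zD)).
  rewrite oppr_lt0 => /h2 h; rewrite wi ler_pdivrMr ?mulr_gt0 //.
  apply: (le_trans (far i ij)); apply: (le_trans (ltW h)).
  by rewrite mulrC ler_pM2l ?dist_gt0' // ler_peMl ?(ltW K0) // ler1n.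
have y0 : 0 < y by rewrite -wy; apply: weight_gt0.
have bp : 0 <= p * (1 + delta) + beta j.
  have := hb j; have : 0 <= p * delta by rewrite mulr_ge0 // ltW.
  by rewrite mulrDr mulr1; lra.
have key1 : La * La * T * (M^-1) `^ p * y <= La * T * s `^ (p * (1 + delta) + beta j).
  apply: (le_trans hL).
  rewrite /wt /weight mulrA -powRD ?(gt_eqF ga) ?implybT //.
  have -> : p * delta + p = p * (1 + delta) by ring.
  apply: (le_trans (ler_wpM2l (powR_ge0 _ _) Pa)).
  rewrite mulrCA -!mulrA ler_pM2l //.
  apply: (@le_trans _ _ ((2 * u) `^ (p * (1 + delta)) * u `^ beta j)).
    rewrite ler_wpM2r ?powR_ge0 //; apply: ge0_ler_powR; rewrite ?nnegrE ?mulr_ge0 ?(ltW ga) ?(ltW u0) //.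
      by rewrite addr_ge0 // ltW.
    exact: gap_le_circle.
  rewrite powRM ?(ltW u0) // -/T -mulrA ler_pM2l // -powRD ?(gt_eqF u0) ?implybT //.
  by apply: ge0_ler_powR; rewrite ?nnegrE ?(ltW u0) ?(ltW s0').
have key2 : gap R z `^ p <= y * (La * s `^ (- beta j)).
  have pz : 0 < prod_dist eta beta z by apply: prod_dist_gt0.
  have -> : gap R z `^ p = y * (prod_dist eta beta z)^-1.
    by rewrite -wy /wt /weight mulfK // gt_eqF.
  by rewrite ler_pM2l.
have key3 : gap R z `^ p <= (M * s `^ (1 + delta)) `^ p.
  have Mp : 0 < (M^-1) `^ p by rewrite powR_gt0 // invr_gt0.
  rewrite -(ler_pM2l Mp) -(ler_pM2l T0) -(ler_pM2l La0).
  have -> : La * (T * (M^-1 `^ p * (M * s `^ (1 + delta)) `^ p)) =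
     La * T * s `^ (p * (1 + delta) + beta j) * s `^ (- beta j).
    rewrite -powRM ?invr_ge0 ?mulr_ge0 ?powR_ge0 ?(ltW M0) // mulKf ?gt_eqF //.
    rewrite -powRrM [(1 + delta) * p]mulrC -[RHS]mulrA -powRD ?(gt_eqF s0') ?implybT //.
    by rewrite addrK mulrA.
  apply: le_trans (ler_wpM2r (powR_ge0 _ _) key1).
  apply: (@le_trans _ _ (La * (T * (M^-1 `^ p * (y * (La * s `^ (- beta j))))))).
    by rewrite !ler_pM2l.
  by rewrite le_eqVlt; apply/orP; left; apply/eqP; ring.
rewrite leNgt; apply/negP => hlt; move: key3; rewrite leNgt => /negP; apply.
by apply: gt0_ltr_powR => //; rewrite nnegrE ?mulr_ge0 ?powR_ge0 ?(ltW M0) ?(ltW gz).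
Qed.

Lemma continuous_cmod : continuous (fun z : C^o => cmod z).
Proof. by move=> z; apply: (continuous_cmod_at R (fun u => u)); apply: cvg_id. Qed.

Lemma continuous_cmodB (b : C) : continuous (fun z : C^o => cmod (z - b)).
Proof.
move=> z; apply: (continuous_cmod_at R (fun w : C => (w - b : C))); apply: (hol_cont R (fun w : C => (w - b : C))).
by apply: holD; [apply: hol_id | apply: hol_cst].
Qed.

(** Truncating gap and the t_j from below at the values they keep on |z| <= r
    gives a function that is continuous everywhere, as [maximum_principle] requires. *)
Lemma weight_continuous_extension p beta r : 0 <= r < 1 ->
  exists2 W : C^o -> R, continuous W & forall z, cmod z <= r -> W z = wt p beta z.
Proof.
move=> /andP[r0 r1].
pose gr z := Num.max (gap R z) (1 - r ^+ 2); pose dr j z := Num.max (dist z j) (1 - r).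
exists (fun z => gr z `^ p * \prod_(j <- index_enum 'I_n) dr j z `^ beta j).
  apply: (continuous_mul R (C^o) (fun z => gr z `^ p)).
    apply: (continuous_powR R (C^o)) => [|w].
      apply: (continuous_max_cst R (C^o)); apply: (continuous_cstB R (C^o) 1 (fun z => cmod z ^+ 2)) => w.
      apply: (@continuous_comp _ _ _ (fun z : C^o => cmod z) (fun x : R => x ^+ 2)); last exact: exprn_continuous.
      exact: continuous_cmod.
    by rewrite /gr lt_max; apply/orP; right; rewrite subr_gt0 expr_lt1.
  apply: (continuous_bigprod R (C^o) _ _ (fun j z => dr j z `^ beta j)) => j.
  apply: (continuous_powR R (C^o)) => [|w].
    by apply: (continuous_max_cst R (C^o)); apply: continuous_cmodB.
  by rewrite /dr lt_max; apply/orP; right; rewrite subr_gt0.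
move=> z zr; rewrite /wt /weight; congr (_ * _).
  by congr (_ `^ _); apply/max_idPl; rewrite /gap lerD2l lerN2 lerXn2r // nnegrE ?cmod_ge0.
apply: eq_bigr => j _; congr (_ `^ _); apply/max_idPl.
apply: le_trans (circle_dist_ge _ _ z (eta_circle j)).
by rewrite lerD2l lerN2.
Qed.

End Counting.

(** * The main estimate *)

Section MainEstimate.
Variables (R : realType) (n : nat) (eta : 'I_n -> R[i]).
Hypothesis n_ge1 : (1 <= n)%N.
Hypothesis eta_inj : injective eta.
Hypothesis eta_circle : forall j, unit_circle (eta j).
Notation C := R[i].
Implicit Types (a z : C) (e q beta : 'I_n -> R) (p delta y : R).

Let wt := weight R n eta.

Lemma div_sqr_half_le (g d x : R) : 0 <= g -> 0 < x -> x / 2 <= d -> g / d ^+ 2 <= 4 * g / x ^+ 2.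
Proof.
move=> g0 x0 xd; have d0 : 0 < d by apply: lt_le_trans xd; rewrite divr_gt0.
have -> : 4 * g / x ^+ 2 = g / (x / 2) ^+ 2 by field; rewrite gt_eqF.
rewrite ler_wpM2l // lef_pV2 ?posrE ?exprn_gt0 ?divr_gt0 //.
by rewrite lerXn2r // nnegrE ltW // divr_gt0.
Qed.

(** The smallness that [sum_multiplicity_le] needs besides the domination by h_a:
    one of the two gaps is at most 2 x and the other at most 2 x / K, while
    |1 - conj(a) z| >= x / 2. *)
Lemma ratio_le_half (ga gz d x K : R) : 0 <= ga -> 0 <= gz -> 32 <= K -> 0 < x -> x / 2 <= d ->
  (ga <= 2 * x /\ gz <= 2 * (x / K)) \/ (gz <= 2 * x /\ ga <= 2 * (x / K)) ->
  ga * (gz / d ^+ 2) <= 1 / 2.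
Proof.
move=> ga0 gz0 K32 x0 xd h; have K0 : 0 < K by apply: lt_le_trans K32.
rewrite mulrA; apply: le_trans (div_sqr_half_le _ _ _ (mulr_ge0 ga0 gz0) x0 xd) _.
have xK : 0 <= x / K by rewrite divr_ge0 // ltW.
have gg : ga * gz <= 2 * x * (2 * (x / K)).
  by case: h => -[h1 h2]; [|rewrite mulrC]; apply: ler_pM.
apply: (@le_trans _ _ (4 * (2 * x * (2 * (x / K))) / x ^+ 2)).
  by rewrite ler_pM2r ?invr_gt0 ?exprn_gt0 // ler_pM2l.
have -> : 4 * (2 * x * (2 * (x / K))) / x ^+ 2 = 16 / K by field; rewrite !gt_eqF.
by rewrite ler_pdivrMr //; lra.
Qed.

Lemma cmod_one_sub_sym a z : cmod (1 - a^* * z) = cmod (1 - z^* * a).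
Proof.
apply/eqP; rewrite -(@eqrXn2 _ 2) ?cmod_ge0 // !cmod_sqr_conj cmod_distC.
by rewrite [X in _ == _ + X]mulrC.
Qed.

Lemma seq_gap_lower (s : seq C) : (forall a, a \in s -> unit_disc a) ->
  exists2 g, 0 < g <= 1 & forall a, a \in s -> g <= gap R a.
Proof.
elim: s => [|b s IH] hs; first by exists 1; rewrite ?ltr01 ?lexx.
have [a sa|g /andP[g0 g1] hg] := IH; first by apply: hs; rewrite inE sa orbT.
exists (Num.min g (gap R b)).
  have bD : unit_disc b by apply: hs; rewrite inE eqxx.
  by rewrite lt_min g0 ge_min g1 (gap_gt0 R b bD).
move=> a; rewrite inE => /orP[/eqP ->|/hg h]; rewrite ge_min ?lexx ?orbT //.
by rewrite h.
Qed.

(** The main estimate; see the introduction. The auxiliary function is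
    h_a = kern_a / K1 + (4 / K1^2) sum_j kern_(eta_j) + 9 M sum_j dkern_j,
    one term for each case of [weight_trichotomy]; K1 is large and M small enough
    for h_a(0) <= 1/4. The level K y is so high that all constants are absorbed and
    that y <= 1 = V(0), which puts 0 into the region. *)
Lemma sum_gap_le p q beta delta : 0 <= p -> 0 < delta < 1 ->
  (forall j, - p <= beta j) -> (forall j, q j - 1 + delta <= beta j) ->
  exists c K, [/\ 0 <= c, 0 < K & forall D f y (s : seq C),
    0 < D -> holomorphic_disc f -> cmod (f 0) = 1 -> growth_bound eta q p D f ->
    0 < y -> uniq s ->
    (forall a, a \in s -> unit_disc a /\ K * y <= gap R a `^ (p * delta) * wt p beta a) ->
    \sum_(a <- s) (multiplicity f a)%:R * gap R a <= D * (c / y)].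
Proof.
move=> p0 d01 hbp hbq; have [d0 d1] := andP d01.
have [sigma s01 sep] := separation R n eta eta_inj.
have [s0 s1] := andP s01.
pose nn : R := n%:R + 1.
have nn1 : 1 <= nn by rewrite /nn lerDr.
have nn0 : 0 < nn by apply: lt_le_trans nn1.
pose S : R := (1 - 2^-1 `^ delta)^-1.
have S0 : 0 < S.
  by rewrite invr_gt0 subr_gt0; case/andP: (half_powR_lt1 R delta d0).
(* 2 / sigma makes the point eta_j of a third case the only one near a *)
pose K1 : R := 32 * nn + 2 / sigma.
have sK : 2 / sigma <= K1 by rewrite /K1 lerDr mulr_ge0 // ltW.
have nK : 32 * nn <= K1 by rewrite /K1 lerDl divr_ge0 // ltW.
have K32 : 32 <= K1 by apply: le_trans nK; rewrite ler_peMr.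
have K1_1 : 1 <= K1 by apply: le_trans K32; rewrite ler1n.
have K1_0 : 0 < K1 by apply: lt_le_trans K1_1.
pose M : R := (72 * nn * S)^-1.
have M0 : 0 < M by rewrite invr_gt0 !mulr_gt0.
have [B [B0 hB]] := weight_bounded R n eta n_ge1 eta_inj eta_circle p beta p0 hbp.
have [c1 c10 hc1] := inv_growth_le R n eta n_ge1 eta_inj eta_circle p q beta delta d01 hbq.
have M4 : 0 < M / 4 by rewrite divr_gt0.
have [L L0 hL] := far_case R n eta eta_circle p beta delta sigma K1 (M / 4) p0 hbp d0 s01 sep K1_1 sK M4.
pose T := K1 `^ (p + \sum_j `|beta j|); have T0 : 0 < T by apply: powR_gt0.
exists (4 * (c1 * (nn * S))), (T + 1 + L + B); split.
- by rewrite !mulr_ge0 // ltW.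
- by rewrite !addr_gt0.
move=> D f y s D0 hf f0 gb y0 us hs.
have sD a : a \in s -> unit_disc a by move=> /hs [].
have gapd a : unit_disc a -> gap R a `^ (p * delta) <= 1.
  move=> aD; rewrite -[leRHS](powRr0 (gap R a)) ger_powR ?gap_gt0 ?gap_le1 //.
  by rewrite mulr_ge0 // ltW.
have wtK a : a \in s -> (T + 1 + L + B) * y <= wt p beta a.
  move=> sa; have [aD h] := hs a sa; apply: (le_trans h).
  by rewrite -[leRHS]mul1r ler_wpM2r ?gapd // ltW // weight_gt0.
have [->|sn0] := eqVneq s [::].
  rewrite big_nil; apply: mulr_ge0; first exact: ltW.
  by apply: divr_ge0; [rewrite !mulr_ge0 // ltW | exact: ltW].
have y1 : y <= 1.
  case: s sn0 us hs sD wtK => // a s' _ _ _ sD wtK.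
  have aa : a \in a :: s' by rewrite inE eqxx.
  have := le_trans (wtK a aa) (hB a (sD a aa)); rewrite -ler_pdivlMl; last by rewrite !addr_gt0.
  move=> h; apply: (le_trans h); rewrite ler_pdivrMl; last by rewrite !addr_gt0.
  by rewrite mulr1 lerDr !addr_ge0 // ltW.
have [g /andP[g0 g1] hg] := seq_gap_lower s sD.
(* so close to 1 that the circle |z| = r always falls under the first case *)
pose r := 1 - g / (2 * K1).
have gK : 0 < g / (2 * K1) by rewrite divr_gt0 // mulr_gt0.
have r1 : r < 1 by rewrite /r gtrBl.
have r0 : 0 <= r.
  rewrite /r subr_ge0 ler_pdivrMr ?mulr_gt0 // mul1r (le_trans g1) //.
  by rewrite -[leLHS]mulr1 ler_pM // ler1n.
have rg : K1 * (1 - r ^+ 2) <= g.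
  have -> : 1 - r ^+ 2 = (1 - r) * (1 + r) by ring.
  have -> : 1 - r = g / (2 * K1) by rewrite /r subKr.
  have -> : K1 * (g / (2 * K1) * (1 + r)) = g * ((1 + r) / 2) by field; rewrite gt_eqF.
  rewrite ler_piMr ?(ltW g0) // ler_pdivrMr // mul1r -[leRHS]/(1 + 1) lerD2l; exact: ltW.
have [N hN] := exists_small_halves R 1 (1 - r) (eq_ind_r is_true gK (congr1 _ (subKr 1 (g / (2 * K1))))).
have {}hN : 2^-1 ^+ N <= 1 - r by rewrite exprVn -[leLHS]mul1r ltW.
have [W cW hW] := weight_continuous_extension R n eta eta_circle p beta r (introT andP (conj r0 r1)).
pose dk j z := dkern R N delta (eta j) z.
pose h a z : C := (K1^-1)%:C * kern R a z + ((4 / K1 ^+ 2)%:C * (\sum_j kern R (eta j) z)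
    + (9 * M)%:C * (\sum_j dk j z)).
pose E z : C := (D * (c1 / y))%:C * (\sum_j dk j z).
have circ1 j : cmod (eta j) <= 1 by rewrite (eta_circle j : cmod _ = 1).
have hdk z : unit_disc z -> hol R (fun z => \sum_j dk j z) z.
  by move=> zD; apply: (hol_sum R _ _ dk) => j; apply: hol_dkern.
have Reh a z : Re (h a z) = K1^-1 * Re (kern R a z) +
    (4 / K1 ^+ 2 * (\sum_j Re (kern R (eta j) z)) + 9 * M * (\sum_j Re (dk j z))).
  by rewrite /h !ReD !Re_realM !Re_sum.
have pos1 a z : unit_disc a -> unit_disc z -> 0 <= K1^-1 * Re (kern R a z).
  by move=> aD zD; rewrite mulr_ge0 ?invr_ge0 ?(ltW K1_0) // Re_kern_ge0 // ltW.
have pos2 z j : unit_disc z -> 0 <= Re (kern R (eta j) z).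
  by move=> zD; rewrite Re_kern_ge0 // ltW.
have pos3 z j : unit_disc z -> 0 <= Re (dk j z) by move=> zD; apply: Re_dkern_ge0.
have c40 : 0 <= 4 / K1 ^+ 2 by rewrite divr_ge0 // sqr_ge0.
have M90 : 0 <= 9 * M by rewrite mulr_ge0 // ltW.
have pos2s z : unit_disc z -> 0 <= 4 / K1 ^+ 2 * (\sum_j Re (kern R (eta j) z)).
  by move=> zD; rewrite mulr_ge0 // sumr_ge0 // => j _; apply: pos2.
have pos3s z : unit_disc z -> 0 <= 9 * M * (\sum_j Re (dk j z)).
  by move=> zD; rewrite mulr_ge0 // sumr_ge0 // => j _; apply: pos3.
have D0' : unit_disc (0 : C) by rewrite /unit_disc /mkset cmod0.
have dk0 : \sum_j Re (dk j 0) <= nn * S.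
  apply: (@le_trans _ _ (\sum_(j < n) S)); first by apply: ler_sum => j _; apply: dkern0_le.
  by rewrite sumr_const card_ord -mulr_natl ler_wpM2r ?(ltW S0) // /nn lerDl.
have goal1 : 4 * Re (E 0) <= D * (4 * (c1 * (nn * S)) / y).
  rewrite /E Re_realM Re_sum.
  have -> : D * (4 * (c1 * (nn * S)) / y) = 4 * (D * (c1 / y) * (nn * S)) by ring.
  by rewrite ler_pM2l // ler_wpM2l // mulr_ge0 ?(ltW D0) // divr_ge0 // ltW.
apply: le_trans goal1.
apply: (sum_multiplicity_le R f s W r y E h hf f0 us sD (introT andP (conj r0 r1)) cW).
- rewrite hW ?cmod0 // /wt /weight /gap cmod0 expr0n subr0 powR1 mul1r /prod_dist.
  rewrite big1 // => j _; rewrite sub0r cmodN (eta_circle j : cmod _ = 1) powR1 //.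
- move=> z zD; apply: (holM R (fun=> (D * (c1 / y))%:C)); first exact: hol_cst.
  exact: hdk.
- move=> a sa z zD; have a1 : cmod a <= 1 by apply/ltW/sD.
  apply: (holD R (fun z => (K1^-1)%:C * kern R a z)).
    by apply: (holM R (fun=> (K1^-1)%:C)); [apply: hol_cst | apply: hol_kern].
  apply: (holD R (fun z => (4 / K1 ^+ 2)%:C * (\sum_j kern R (eta j) z))).
    apply: (holM R (fun=> (4 / K1 ^+ 2)%:C)); first exact: hol_cst.
    by apply: (hol_sum R _ _ (fun j => kern R (eta j))) => j; apply: hol_kern.
  by apply: (holM R (fun=> (9 * M)%:C)); [apply: hol_cst | apply: hdk].
- move=> z zr; rewrite hW // => yz hz.
  have zD : unit_disc z by apply: le_lt_trans zr r1.
  have gz := gap_gt0 R z zD.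
  split.
    apply: le_trans (gb z zD) _; rewrite ler_expR /E Re_realM Re_sum -mulrA ler_pM2l //.
    apply: hc1 => //; apply: (le_trans hN); by rewrite lerD2l lerN2.
  move=> a sa; have aD := sD a sa; have ga := gap_gt0 R a aD.
  have wa := wtK a sa; have [_ hta] := hs a sa.
  have dpos : 0 < cmod (1 - a^* * z) by apply: cmod_one_sub => //; apply: ltW.
  have tri : [\/ K1 * gap R z <= gap R a,
      exists2 j, 0 < beta j & K1 * cmod (z - eta j) <= cmod (a - eta j) |
      wt p beta z = y /\ (exists j, [/\ beta j < 0, K1 * cmod (a - eta j) <= cmod (z - eta j) &
        forall i, 0 < beta i -> cmod (a - eta i) < K1 * cmod (z - eta i)])].
    case: hz => [hz|hz].
      by constructor 1; apply: le_trans (hg a sa); rewrite {1}/gap hz.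
    have h1 : T * wt p beta z < wt p beta a.
      apply: lt_le_trans wa; rewrite (hz : wt p beta z = y) ltr_pM2r // -!addrA ltrDl.
      by rewrite !addr_gt0.
    have [c|c|[j bj c]] := weight_trichotomy R n eta eta_circle p beta K1 a z p0 K1_1 aD zD h1.
    - by constructor 1.
    - by constructor 2.
    have [c2|/forall2NP c2] := pselect (exists2 j, 0 < beta j & K1 * cmod (z - eta j) <= cmod (a - eta j)).
      by constructor 2.
    constructor 3; split=> //; exists j; split=> // i bi.
    by have [|/negP] := c2 i; [rewrite bi | rewrite -ltNge].
  set d := cmod (1 - a^* * z) in dpos *.
  rewrite Reh; case: tri => [c|[j bj c]|[wy [j [bj c c2]]]].
  + split.
      apply: (@le_trans _ _ (K1^-1 * Re (kern R a z))); last first.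
        by rewrite lerDl addr_ge0 ?pos2s ?pos3s.
      apply: (@le_trans _ _ (K1^-1 * (gap R a / d ^+ 2))).
        rewrite mulrA ler_pM2r ?invr_gt0 ?exprn_gt0 // ler_pdivlMl //.
      rewrite ler_pM2l ?invr_gt0 //.
      by have [] := kern_ge_gap R a z (ltW aD) (ltW zD).
    apply: (ratio_le_half _ _ _ (gap R a) K1) => //; try exact: ltW.
      have h1 : 1 - cmod a <= d.
        have := cmod_dist_le R 1 (a^* * z); rewrite -/d cmod1 cmodM cmod_conj => h2.
        apply: le_trans (le_trans (ler_norm _) h2).
        by rewrite lerD2l lerN2 ler_piMr ?cmod_ge0 // ltW.
      apply: le_trans h1; rewrite ler_pdivrMr // mulrC; exact: gap_le_2dist.
    left; split; first by rewrite ler_peMl ?ler1n // ltW.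
    have : gap R z <= gap R a / K1 by rewrite ler_pdivlMr // mulrC.
    move=> h1; apply: (le_trans h1); rewrite ler_peMl ?ler1n // divr_ge0 // ltW //.
  + set u := cmod (a - eta j) in c; set v := cmod (z - eta j) in c.
    have u0 : 0 < u by apply: circle_dist_gt0.
    have v0 : 0 < v by apply: circle_dist_gt0.
    have ud : u / 2 <= d.
      by apply: (half_dist_le R (eta j) a z K1) => //; [apply: ltW | apply: le_trans K32; rewrite ler_nat].
    have vu : v <= u / K1 by rewrite ler_pdivlMr // mulrC.
    split.
      apply: (@le_trans _ _ (4 / K1 ^+ 2 * (\sum_j Re (kern R (eta j) z)))); last first.
        by rewrite addrCA lerDl addr_ge0 ?pos1 ?pos3s.
      apply: (@le_trans _ _ (4 / K1 ^+ 2 * Re (kern R (eta j) z))); last first.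
        by rewrite ler_wpM2l // (bigD1 j) //= lerDl sumr_ge0 // => i _; apply: pos2.
      apply: (le_trans (div_sqr_half_le _ _ _ (ltW gz) u0 ud)).
      apply: (@le_trans _ _ (4 / K1 ^+ 2 * (gap R z / v ^+ 2))); last first.
        rewrite ler_wpM2l //; have [h1 _] := kern_ge_gap R (eta j) z (circ1 j) (ltW zD).
        by apply: le_trans h1; rewrite cmod_circle.
      have -> : 4 / K1 ^+ 2 * (gap R z / v ^+ 2) = 4 * gap R z / (K1 * v) ^+ 2.
        by field; rewrite !gt_eqF.
      rewrite ler_pM2l ?mulr_gt0 // lef_pV2 ?posrE ?exprn_gt0 ?mulr_gt0 //.
      by rewrite lerXn2r // nnegrE ?mulr_ge0 // ltW.
    apply: (ratio_le_half _ _ _ u K1) => //; try exact: ltW.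
    left; split; first exact: gap_le_circle.
    by apply: le_trans (gap_le_circle R _ _ (eta_circle j) zD) _; rewrite ler_pM2l.
  + set u := cmod (a - eta j) in c; set v := cmod (z - eta j) in c.
    have u0 : 0 < u by apply: circle_dist_gt0.
    have v0 : 0 < v by apply: circle_dist_gt0.
    have vd : v / 2 <= d.
      rewrite /d cmod_one_sub_sym.
      by apply: (half_dist_le R (eta j) z a K1) => //; [apply: ltW | apply: le_trans K32; rewrite ler_nat].
    have uv : u <= v / K1 by rewrite ler_pdivlMr // mulrC.
    have gzv : gap R z <= M / 4 * v `^ (1 + delta).
      apply: (hL a z y j) => //; apply: le_trans hta; rewrite ler_pM2r //.
      by rewrite -addrA addrCA lerDl !addr_ge0 // ltW.
    split.
      apply: (@le_trans _ _ (9 * M * (\sum_j Re (dk j z)))); last first.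
        by rewrite addrA lerDr addr_ge0 ?pos1 ?pos2s.
      apply: (@le_trans _ _ (9 * M * Re (dk j z))); last first.
        by rewrite ler_wpM2l // (bigD1 j) //= lerDl sumr_ge0 // => i _; apply: pos3.
      apply: (le_trans (div_sqr_half_le _ _ _ (ltW gz) v0 vd)).
      apply: (@le_trans _ _ (4 * (M / 4 * v `^ (1 + delta)) / v ^+ 2)).
        by rewrite ler_pM2r ?invr_gt0 ?exprn_gt0 // ler_pM2l.
      have -> : 4 * (M / 4 * v `^ (1 + delta)) / v ^+ 2 = M * v `^ (- (1 - delta)).
        have -> : - (1 - delta) = (1 + delta) - 2 by ring.
        rewrite powRB ?(gt_eqF v0) ?implybT // -[2 in RHS]/(2%:R) powR_mulrn ?(ltW v0) //.
        by field; rewrite gt_eqF.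
      have -> : 9 * M * Re (dk j z) = M * (9 * Re (dk j z)) by ring.
      rewrite ler_pM2l //; apply: dkern_ge => //; apply: (le_trans hN).
      apply: le_trans (circle_dist_ge R _ z (eta_circle j)); by rewrite lerD2l lerN2.
    apply: (ratio_le_half _ _ _ v K1) => //; try exact: ltW.
    right; split; first exact: gap_le_circle.
    by apply: le_trans (gap_le_circle R _ _ (eta_circle j) aD) _; rewrite ler_pM2l.
- move=> a sa; rewrite Reh kern_at0 mulr1.
  have -> : \sum_j Re (kern R (eta j) 0) = n%:R.
    under eq_bigr do rewrite kern_at0.
    by rewrite sumr_const card_ord.
  have h1 : K1^-1 <= 1 / 32 by rewrite div1r lef_pV2 ?posrE.
  have h2 : 4 / K1 ^+ 2 * n%:R <= 1 / 32.
    have -> : 4 / K1 ^+ 2 * n%:R = 4 / K1 * (n%:R / K1) by field; rewrite gt_eqF.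
    have k1 : n%:R / K1 <= 1 / 32 by rewrite ler_pdivrMr //; move: nK; rewrite /nn; lra.
    have k2 : 4 / K1 <= 1 by rewrite ler_pdivrMr //; move: K32; lra.
    by rewrite -[leRHS]mul1r ler_pM // divr_ge0 // ltW.
  have h3 : 9 * M * (\sum_j Re (dk j 0)) <= 1 / 8.
    apply: (le_trans (ler_wpM2l M90 dk0)).
    by rewrite /M le_eqVlt; apply/orP; left; apply/eqP; field; rewrite !gt_eqF.
  move: h1 h2 h3; lra.
Qed.

End MainEstimate.

(** * Summation over dyadic levels *)

Section Dyadic.
Variable R : realType.
Implicit Types (x y delta : R).

(** Layer cake over the levels B 2^-k: the elements with v a between B 2^-k and
    2 B 2^-k contribute at most (2 B 2^-k)^(1 + delta) A / (B 2^-k), a geometric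
    sequence. *)
Lemma dyadic_summation (T : eqType) (s : seq T) (mu v : T -> R) (A B delta : R) :
  0 < B -> 0 < delta -> (forall a, a \in s -> 0 <= mu a) -> (forall a, a \in s -> 0 < v a <= B) ->
  (forall y, 0 < y -> \sum_(a <- s | y <= v a) mu a <= A / y) ->
  \sum_(a <- s) mu a * v a `^ (1 + delta) <=
    A * (2 * (2 * B) `^ delta * (1 - 2^-1 `^ delta)^-1).
Proof.
move=> B0 d0 mu0 vB hy.
have [N hN] : exists N, forall a, a \in s -> B * 2^-1 ^+ N <= v a.
  elim: s mu0 vB {hy} => [|b s IH] mu0 vB; first by exists 0%N.
  have [a sa|a sa|N hN] := IH; first by apply: mu0; rewrite inE sa orbT.
    by apply: vB; rewrite inE sa orbT.
  have /andP[b0 _] : 0 < v b <= B by apply: vB; rewrite inE eqxx.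
  have [k hk] := exists_small_halves R B (v b) b0.
  exists (maxn N k) => a; rewrite inE => /orP[/eqP ->|/hN h].
    apply: ltW; apply: le_lt_trans hk; rewrite ler_pM2l // -exprVn.
    by apply: ler_wiXn2l; rewrite ?leq_maxr // ?invr_ge0 // invf_le1 // ler1n.
  apply: le_trans h; rewrite ler_pM2l //.
  by apply: ler_wiXn2l; rewrite ?leq_maxl // ?invr_ge0 // invf_le1 // ler1n.
pose t k : R := B * 2^-1 ^+ k.
have t0 k : 0 < t k by rewrite mulr_gt0 // exprn_gt0 // invr_gt0.
have step a : a \in s -> mu a * v a `^ (1 + delta) <=
    \sum_(k < N.+1) (if t k <= v a then (2 * t k) `^ (1 + delta) * mu a else 0).
  move=> sa; have /andP[v0 v1] := vB a sa.
  have [||k kN] := dyadic_scale R N (v a / B).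
  - by rewrite ler_pdivlMr // mulrC hN.
  - by rewrite ler_pdivrMr // (le_trans v1) // ler_peMl ?ler1n // ltW.
  rewrite ler_pdivlMr // ler_pdivrMr // => /andP[h1 h2].
  rewrite (bigD1 (Ordinal kN)) //= /t mulrC [B * _]mulrC h1 -[leLHS]addr0 lerD //.
    rewrite ler_wpM2r ?mu0 //; apply: ge0_ler_powR; rewrite ?nnegrE.
    - by rewrite addr_ge0 // ltW.
    - exact: ltW.
    - by rewrite !mulr_ge0 ?exprn_ge0 ?invr_ge0 // ltW.
    - by rewrite mulrA.
  apply: sumr_ge0 => i _; case: ifP => // _; by rewrite mulr_ge0 ?powR_ge0 ?mu0.
apply: (@le_trans _ _ (\sum_(a <- s) \sum_(k < N.+1)
    (if t k <= v a then (2 * t k) `^ (1 + delta) * mu a else 0))).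
  by rewrite big_seq [leRHS]big_seq; apply: ler_sum.
rewrite exchange_big /=.
set x := 2^-1 `^ delta.
apply: (@le_trans _ _ (\sum_(k < N.+1) A * (2 * (2 * B) `^ delta) * x ^+ k)).
  apply: ler_sum => k _; rewrite -big_mkcond /= -big_distrr /=.
  apply: (@le_trans _ _ ((2 * t k) `^ (1 + delta) * (A / t k))).
    by rewrite ler_wpM2l ?powR_ge0 // hy.
  have tk2 : 0 < 2 * t k by rewrite mulr_gt0.
  rewrite powRD ?(gt_eqF tk2) ?implybT // powRr1 ?(ltW tk2) //.
  have -> : (2 * t k) `^ delta = (2 * B) `^ delta * x ^+ k.
    rewrite /t mulrA powRM ?mulr_ge0 ?exprn_ge0 ?invr_ge0 ?(ltW B0) //; congr (_ * _).
    by rewrite /x -[in RHS]powR_mulrn ?powR_ge0 // -powRrM [delta * _]mulrC powRrM powR_mulrn ?invr_ge0.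
  by rewrite le_eqVlt; apply/orP; left; apply/eqP; field; rewrite gt_eqF.
rewrite -mulr_sumr -!mulrA.
have A0 : 0 <= A.
  have := hy 1 ltr01; rewrite divr1; apply: le_trans; rewrite big_seq_cond.
  by apply: sumr_ge0 => a /andP[sa _]; apply: mu0.
rewrite ler_wpM2l // ler_pM2l // ler_wpM2l ?powR_ge0 //.
exact/geometric_sum_le/half_powR_lt1.
Qed.

End Dyadic.
Section Summation.
Variables (R : realType) (n : nat) (eta : 'I_n -> R[i]).
Hypothesis n_ge1 : (1 <= n)%N.
Hypothesis eta_inj : injective eta.
Hypothesis eta_circle : forall j, unit_circle (eta j).
Notation C := R[i].
Implicit Types (a z : C) (e q beta : 'I_n -> R) (p delta y : R).

Let wt := weight R n eta.

Lemma sum_gap_weight_le p q beta delta : 0 <= p -> 0 < delta < 1 ->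
  (forall j, - p <= beta j) -> (forall j, q j - 1 + delta <= beta j) ->
  exists2 c, 0 <= c & forall D f (s : seq C),
    0 < D -> holomorphic_disc f -> cmod (f 0) = 1 -> growth_bound eta q p D f ->
    uniq s -> (forall a, a \in s -> unit_disc a) ->
    \sum_(a <- s) (multiplicity f a)%:R * gap R a *
       (gap R a `^ (p * delta) * wt p beta a) `^ (1 + delta) <= D * c.
Proof.
move=> p0 d01 hbp hbq; have [d0 d1] := andP d01.
have [B [B0 hB]] := weight_bounded R n eta n_ge1 eta_inj eta_circle p beta p0 hbp.
have [c [K [c0 K0 hc]]] := sum_gap_le R n eta n_ge1 eta_inj eta_circle p q beta delta p0 d01 hbp hbq.
pose X := 2 * (2 * B) `^ delta * (1 - 2^-1 `^ delta)^-1.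
have X0 : 0 <= X.
  have /andP[_ h] := half_powR_lt1 R delta d0.
  by rewrite !mulr_ge0 ?powR_ge0 // invr_ge0 subr_ge0 ltW.
exists (c * K * X); first by rewrite mulr_ge0 // mulr_ge0 // ltW.
move=> D f s D0 hf f0 gb us sD.
rewrite mulrA; apply: dyadic_summation => //.
- by move=> a sa; rewrite mulr_ge0 // (ltW (gap_gt0 R a (sD a sa))).
- move=> a sa; have aD := sD a sa; have ga := gap_gt0 R a aD.
  have w0 : 0 < wt p beta a by apply: weight_gt0.
  rewrite mulr_gt0 ?powR_gt0 //=; apply: le_trans (hB a aD).
  rewrite ler_piMl ?(ltW w0) // -[leRHS](powRr0 (gap R a)) ger_powR ?ga ?gap_le1 //.
  by rewrite mulr_ge0 // ltW.
move=> y y0; rewrite -big_filter.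
have -> : D * (c * K) / y = D * (c / (y / K)) by field; rewrite !gt_eqF.
apply: hc => //; [by rewrite divr_gt0 | exact: filter_uniq |].
move=> a; rewrite mem_filter => /andP[h sa]; split; first exact: sD.
by rewrite mulrC divfK ?gt_eqF.
Qed.

Lemma prod_dist_powR e r z : unit_disc z -> prod_dist eta e z `^ r = prod_dist eta (fun j => e j * r) z.
Proof.
move=> zD; rewrite /prod_dist.
have -> : (\prod_(j < n) cmod (z - eta j) `^ e j) `^ r = \prod_(j < n) (cmod (z - eta j) `^ e j) `^ r.
  elim: (index_enum _) => [|j s IH]; first by rewrite !big_nil powR1.
  by rewrite !big_cons powRM ?powR_ge0 ?IH // prodr_ge0 // => i _; apply: powR_ge0.
by apply: eq_bigr => j _; rewrite -powRrM.
Qed.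

Lemma prod_dist_le e e' : (forall j, e' j <= e j) ->
  exists2 c, 0 < c & forall z, unit_disc z -> prod_dist eta e z <= c * prod_dist eta e' z.
Proof.
move=> h; exists (\prod_(j < n) 2 `^ (e j - e' j)); first by apply: prodr_gt0 => j _; apply: powR_gt0.
move=> z zD; rewrite /prod_dist -big_split /=; apply: ler_prod => j _; rewrite powR_ge0 /=.
have d0 : 0 < cmod (z - eta j) by apply: circle_dist_gt0.
have -> : cmod (z - eta j) `^ e j = cmod (z - eta j) `^ (e j - e' j) * cmod (z - eta j) `^ e' j.
  by rewrite -powRD ?(gt_eqF d0) ?implybT // subrK.
rewrite ler_wpM2r ?powR_ge0 //; apply: ge0_ler_powR; rewrite ?subr_ge0 ?nnegrE ?(ltW d0) //.
exact: circle_dist_le2.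
Qed.

(** A sum over a possibly infinite set of zeros is the supremum of its finite
    partial sums, so bounds for finite sequences of points are enough. *)
Lemma sum_zeros_le f (w w' : C -> R) (c M : R) : 0 <= c ->
  (forall a, unit_disc a -> w a <= c * w' a) ->
  (forall s : seq C, uniq s -> (forall a, a \in s -> unit_disc a) ->
     \sum_(a <- s) (multiplicity f a)%:R * w' a <= M) ->
  (sum_zeros f w <= (c * M)%:E)%E.
Proof.
move=> c0 hw hM; apply: ge_ereal_sup => _ [A [finA Az] <-].
rewrite fsumEFin // fsbig_finite //= lee_fin.
pose s : seq C := finmap.enum_fset (fset_set A).
have sD a : a \in s -> unit_disc a.
  by move=> sa; have : a \in A; [rewrite -(in_fset_set finA) | rewrite inE => /Az []].
apply: (@le_trans _ _ (c * \sum_(a <- s) (multiplicity f a)%:R * w' a)).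
  rewrite mulr_sumr big_seq [leRHS]big_seq; apply: ler_sum => a sa.
  by rewrite mulrCA ler_wpM2l // hw //; apply: sD.
rewrite ler_wpM2l // hM //; exact: finmap.fset_uniq.
Qed.

Lemma small_delta p e eps : 0 <= p -> 0 < eps ->
  exists2 delta, 0 < delta < 1 &
    3 * p * delta + n%:R * (delta * (\sum_j `|e j| + 1)) <= eps.
Proof.
move=> p0 e0; pose Q := \sum_j `|e j| + 1.
have Q0 : 0 < Q by rewrite ltr_wpDl // sumr_ge0.
pose T := 3 * p + n%:R * Q.
have T0 : 0 <= T by rewrite addr_ge0 // mulr_ge0 // ltW.
have T1 : 0 < T + 1 by rewrite ltr_wpDl.
exists (Num.min 2^-1 (eps / (T + 1))).
  by rewrite lt_min invr_gt0 ltr0n divr_gt0 //= gt_min invf_lt1 // ltr1n.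
set d := Num.min _ _.
have -> : 3 * p * d + n%:R * (d * (\sum_j `|e j| + 1)) = T * d by rewrite /T /Q; ring.
have d0 : 0 <= d by rewrite le_min invr_ge0 ler0n divr_ge0 // ltW.
have : d <= eps / (T + 1) by rewrite ge_min lexx orbT.
rewrite ler_pdivlMr // mulrDr mulr1 mulrC => h.
by apply: le_trans h; rewrite lerDl.
Qed.

End Summation.

(** * The two cases *)

Section Conclusion.
Variables (R : realType) (n : nat) (eta : 'I_n -> R[i]).
Hypothesis n_ge1 : (1 <= n)%N.
Hypothesis eta_inj : injective eta.
Hypothesis eta_circle : forall j, unit_circle (eta j).
Notation C := R[i].
Implicit Types (a z : C) (e q beta : 'I_n -> R) (p delta y : R).

Lemma weight_power p beta delta a : unit_disc a ->
  gap R a * (gap R a `^ (p * delta) * weight R n eta p beta a) `^ (1 + delta) =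
  gap R a `^ (1 + p * (1 + delta) ^+ 2) * prod_dist eta (fun j => beta j * (1 + delta)) a.
Proof.
move=> aD; have ga := gap_gt0 R a aD.
have pd := prod_dist_gt0 R n eta eta_circle beta a aD.
rewrite /weight mulrA -powRD ?(gt_eqF ga) ?implybT // powRM ?powR_ge0 ?(ltW pd) //.
rewrite prod_dist_powR // mulrA; congr (_ * _).
rewrite -powRrM -{1}[gap R a]powRr1 ?(ltW ga) // -powRD ?(gt_eqF ga) ?implybT //.
by congr (_ `^ _); ring.
Qed.

Lemma sum_zeros_bound p q beta delta (w : C -> R) c0 : 0 <= p -> 0 < delta < 1 ->
  (forall j, - p <= beta j) -> (forall j, q j - 1 + delta <= beta j) -> 0 <= c0 ->
  (forall a, unit_disc a -> w a <= c0 *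
     (gap R a `^ (1 + p * (1 + delta) ^+ 2) * prod_dist eta (fun j => beta j * (1 + delta)) a)) ->
  exists c : R, forall D f, 0 < D -> holomorphic_disc f -> cmod (f 0) = 1 ->
    growth_bound eta q p D f -> (sum_zeros f w <= (D * c)%:E)%E.
Proof.
move=> p0 d01 hbp hbq c00 hw.
have [c _ hc] := sum_gap_weight_le R n eta n_ge1 eta_inj eta_circle p q beta delta p0 d01 hbp hbq.
exists (c0 * c) => D f D0 hf f0 gb; rewrite mulrCA.
apply: (sum_zeros_le R f w _ c0 _ c00 hw) => s us sD.
apply: le_trans (hc D f s D0 hf f0 gb us sD).
rewrite le_eqVlt; apply/orP; left; apply/eqP; apply: eq_big_seq => a sa.
by rewrite -mulrA weight_power //; apply: sD.
Qed.

Lemma exponent_gain (x delta : R) : 0 < delta < 1 ->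
  (x - 1 + delta) * (1 + delta) <= x - 1 + delta * (`|x| + 1).
Proof.
move=> /andP[d0 d1].
have -> : (x - 1 + delta) * (1 + delta) = x - 1 + delta * (x + delta) by ring.
by rewrite lerD2l ler_pM2l // lerD ?ler_norm // ltW.
Qed.

Lemma term_le_sum e j : `|e j| + 1 <= \sum_i `|e i| + 1.
Proof. by rewrite lerD2r (bigD1 j) //= lerDl sumr_ge0. Qed.

Lemma zeros_bound_p0 q eps : 0 < eps ->
  exists c : R, forall D f, 0 < D -> holomorphic_disc f -> cmod (f 0) = 1 ->
    growth_bound eta q 0 D f ->
    (sum_zeros f (fun a =>
       (1 - cmod a) * prod_dist eta (fun j => pos_part (q j - 1 + eps)) a)%R <= (D * c)%:E)%E.
Proof.
move=> e0; have [delta d01 hd] := small_delta R n 0 q eps (lexx 0) e0; have [d0 d1] := andP d01.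
have heps : delta * (\sum_i `|q i| + 1) <= eps.
  apply: le_trans hd; rewrite mulr0 mul0r add0r ler_peMl ?ler1n //.
  by rewrite mulr_ge0 ?addr_ge0 ?sumr_ge0 // ltW.
pose beta j := pos_part (q j - 1 + delta).
have b0 j : 0 <= beta j by rewrite /beta /pos_part le_max lexx orbT.
have hb j : beta j * (1 + delta) <= pos_part (q j - 1 + eps).
  rewrite /beta {1}/pos_part /pos_part; case: (lerP (q j - 1 + delta) 0) => h.
    by rewrite mul0r le_max lexx orbT.
  rewrite le_max; apply/orP; left; apply: le_trans (exponent_gain _ _ d01) _.
  rewrite lerD2l; apply: le_trans heps; by rewrite ler_pM2l // term_le_sum.
have [c1 c10 hc1] := prod_dist_le R n eta eta_circle _ _ hb.
apply: (sum_zeros_bound 0 q beta delta _ c1) => //.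
- by move=> j; rewrite oppr0.
- by move=> j; rewrite /beta /pos_part le_max lexx.
- exact: ltW.
move=> a aD; rewrite mul0r addr0 powRr1 ?(ltW (gap_gt0 R a aD)) // mulrCA.
have h : 0 <= 1 - cmod a by rewrite subr_ge0 ltW.
apply: ler_pM => //; last exact: hc1.
  exact: ltW (prod_dist_gt0 _ _ _ eta_circle _ _ aD).
exact: dist_le_gap.
Qed.

(** A power of the gap pays for a power x of each t_j, because gap <= 2 t_j. *)
Lemma gap_prod_dist_le e x a : 0 <= x -> unit_disc a ->
  gap R a `^ (n%:R * x) * prod_dist eta e a <=
    (2 `^ x) ^+ n * prod_dist eta (fun j => e j + x) a.
Proof.
move=> x0 aD; have ga := gap_gt0 R a aD.
rewrite mulrC powRrM powRAC powR_mulrn ?powR_ge0 //.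
have cst (u : R) : u ^+ n = \prod_(j < n) u by rewrite prodr_const card_ord.
rewrite !cst /prod_dist -!big_split /=; apply: ler_prod => j _.
have d0 : 0 < cmod (a - eta j) by apply: circle_dist_gt0.
rewrite mulr_ge0 ?powR_ge0 //= powRD ?(gt_eqF d0) ?implybT // mulrCA ler_wpM2l ?powR_ge0 //.
rewrite -powRM ?(ltW d0) //; apply: ge0_ler_powR; rewrite ?nnegrE ?mulr_ge0 ?(ltW d0) ?(ltW ga) //.
exact: gap_le_circle.
Qed.

Lemma zeros_bound_pos p q (qt : 'I_n -> R) eps : 0 < p ->
  (forall j, if - (p / 2) < q j - 1 then qt j = q j else 1 - p / 2 < qt j) -> 0 < eps ->
  exists c : R, forall D f, 0 < D -> holomorphic_disc f -> cmod (f 0) = 1 ->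
    growth_bound eta q p D f ->
    (sum_zeros f (fun a =>
       (1 - cmod a) `^ (1 + p + eps) * prod_dist eta (fun j => qt j - 1) a)%R <= (D * c)%:E)%E.
Proof.
move=> p0 hq e0; have p0' := ltW p0.
have [delta d01 hd] := small_delta R n p qt eps p0' e0; have [d0 d1] := andP d01.
pose x := delta * (\sum_j `|qt j| + 1).
have x0 : 0 <= x by rewrite mulr_ge0 ?addr_ge0 ?sumr_ge0 // ltW.
pose beta j := qt j - 1 + delta.
have hb j : beta j * (1 + delta) <= qt j - 1 + x.
  apply: le_trans (exponent_gain _ _ d01) _; by rewrite lerD2l ler_pM2l // term_le_sum.
have [c1 c10 hc1] := prod_dist_le R n eta eta_circle _ _ hb.
apply: (sum_zeros_bound p q beta delta _ ((2 `^ x) ^+ n * c1)) => //.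
- by move=> j; have := hq j; rewrite /beta; case: ifP => [h -> | _ h]; move: p0 d0 h; lra.
- move=> j; have := hq j; rewrite /beta lerD2r lerD2r.
  by case: ltrP => [_ -> // | h1 h2]; move: h1 h2; lra.
- by rewrite mulr_ge0 ?exprn_ge0 ?powR_ge0 // ltW.
move=> a aD; have ga := gap_gt0 R a aD.
have h : 0 <= 1 - cmod a by rewrite subr_ge0 ltW.
have pd f := ltW (prod_dist_gt0 R n eta eta_circle f a aD).
apply: (@le_trans _ _ (gap R a `^ (1 + p * (1 + delta) ^+ 2) *
    (gap R a `^ (n%:R * x) * prod_dist eta (fun j => qt j - 1) a))).
  rewrite mulrA -powRD ?(gt_eqF ga) ?implybT // ler_wpM2r //.
  apply: (@le_trans _ _ (gap R a `^ (1 + p + eps))).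
    apply: ge0_ler_powR; rewrite ?nnegrE ?(ltW ga) //; last exact: dist_le_gap.
    by rewrite !addr_ge0 // ltW.
  rewrite ger_powR ?ga ?gap_le1 //.
  have : p * (1 + delta) ^+ 2 <= p + 3 * p * delta.
    have -> : p + 3 * p * delta = p * (1 + 3 * delta) by ring.
    rewrite ler_pM2l // expr2; nra.
  by move: hd; rewrite -/x; lra.
rewrite [leRHS]mulrCA ler_wpM2l ?powR_ge0 //.
apply: (le_trans (gap_prod_dist_le _ _ _ x0 aD)).
by rewrite -[leRHS]mulrA ler_wpM2l ?exprn_ge0 ?powR_ge0 // hc1.
Qed.

End Conclusion.

Theorem theorem1p3 (R : realType) (n : nat) (eta : 'I_n -> R[i])
    (q : 'I_n -> R)
    (n_ge1 : (1 <= n)%N)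
    (eta_inj : injective eta)
    (eta_circle : forall j, unit_circle (eta j)) :
  (forall eps : R, 0 < eps ->
     exists c : R, forall (D : R) (f : R[i] -> R[i]),
       0 < D -> holomorphic_disc f -> cmod (f 0) = 1 ->
       growth_bound eta q 0 D f ->
       (sum_zeros f (fun a =>
          (1 - cmod a) * prod_dist eta (fun j => pos_part (q j - 1 + eps)) a)%R
        <= (D * c)%:E)%E)
  /\
  (forall (p : R) (qt : 'I_n -> R) (eps : R),
     0 < p ->
     (forall j, if - (p / 2) < q j - 1 then qt j = q j
                else 1 - p / 2 < qt j) ->
     0 < eps ->
     exists c : R, forall (D : R) (f : R[i] -> R[i]),
       0 < D -> holomorphic_disc f -> cmod (f 0) = 1 ->
       growth_bound eta q p D f ->
       (sum_zeros f (fun a =>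
          (1 - cmod a) `^ (1 + p + eps) *
            prod_dist eta (fun j => qt j - 1) a)%R
        <= (D * c)%:E)%E).
Proof.
split; first by move=> eps; apply: zeros_bound_p0.
by move=> p qt eps; apply: zeros_bound_pos.
Qed.
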